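(* Let $0<p<1$ be a constant, $s\ge 3$ be a fixed integer and $G=G(n,p)$. Then with high probability (probability tending to $1$ as $n\to\infty$), $G$ contains a $K_s$-saturated subgraph with $(1+o(1))\,n\log_{1/(1-p)} n$ edges.
   Context: $G(n,p)$ denotes the Erdős–Rényi random graph on vertex set $[n]$ in which each pair of vertices is an edge independently with probability $p$. A subgraph $H\subseteq G$ is $K_s$-saturated in $G$ if $H$ contains no copy of $K_s$ (complete graph on $s$ vertices) but adding to $H$ any edge of $G$ not in $H$ creates a copy of $K_s$. The $o(1)$ term tends to $0$ as $n\to\infty$. *)

(* Defs.v *)
From HB Require Import structures.
From mathcomp Require Export all_boot all_order all_algebra.
From mathcomp Require Export all_classical all_reals all_analysis.
Export Order.TTheory GRing.Theory Num.Theory.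
Export numFieldNormedType.Exports.

Set Implicit Arguments.
Unset Strict Implicit.
Unset Printing Implicit Defensive.

Local Open Scope ring_scope.

(* A simple graph with vertex set T is identified with its edge set, a set of
   two-element subsets of T; hence all subgraphs below are spanning. *)
Definition vpairs (T : finType) : {set {set T}} :=
  [set e : {set T} | #|e| == 2%N]%SET.

Definition is_clique (T : finType) (E : {set {set T}}) (K : {set T}) : bool :=
  [forall x in K, forall y in K, (x != y) ==> ([set x; y]%SET \in E)].

Definition contains_K (s : nat) (T : finType) (E : {set {set T}}) : bool :=
  [exists K : {set T}, (#|K| == s) && is_clique E K].

Definition K_saturated (s : nat) (T : finType) (G H : {set {set T}}) : bool :=
  [&& H \subset G, ~~ contains_K s H &
      [forall e in G :\: H, contains_K s (e |: H)]].

Definition gnp_mass (R : realType) (n : nat) (p : R)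
    (G : {set {set 'I_n}}) : R :=
  \prod_(e in vpairs 'I_n) (if e \in G then p else 1 - p).

Definition gnp_prob (R : realType) (n : nat) (p : R)
    (A : pred {set {set 'I_n}}) : R :=
  \sum_(G in powerset (vpairs 'I_n) | A G) gnp_mass p G.

Definition logb (R : realType) (b x : R) : R := ln x / ln b.

Lemma gnp_probT (R : realType) (n : nat) (p : R) :
  gnp_prob p (fun _ : {set {set 'I_n}} => true) = 1.
Proof.
pose V := vpairs 'I_n.
pose F e : R := if e \in V then p else 0.
pose C e : R := if e \in V then 1 - p else 1.
transitivity (\prod_e (F e + C e)); last first.
  apply: big1 => e _; rewrite /F /C; case: ifP => _; last by rewrite add0r.
  by rewrite addrC subrK.
rewrite bigA_distr /gnp_prob [RHS](bigID (fun G : {set {set 'I_n}} => G \subset V)) /=.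
rewrite [X in _ = _ + X]big1 ?addr0; last first.
  move=> G /subsetPn[e eG eV].
  by rewrite (bigD1 e) //= eG /F (negbTE eV) mul0r.
apply: eq_big => [G|G]; first by rewrite powersetE andbT.
rewrite powersetE andbT => GV.
rewrite [RHS](bigID (mem V)) /= [X in _ * X]big1 ?mulr1.
  by apply: eq_bigr => e eV; rewrite /F /C eV.
move=> e eV; rewrite /C (negbTE eV).
by case: ifP => // /(fintype.subsetP GV); rewrite (negbTE eV).
Qed.

Lemma gnp_prob_edge (R : realType) (n : nat) (p : R) (e : {set 'I_n}) :
  e \in vpairs 'I_n ->
  gnp_prob p (fun G : {set {set 'I_n}} => e \in G) = p.
Proof.
move=> eE; pose V := vpairs 'I_n.
pose F f : R := if f \in V then p else 0.
pose C f : R := if f \in V then (if f == e then 0 else 1 - p) else 1.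
transitivity (\prod_f (F f + C f)); last first.
  rewrite (bigD1 e) //= big1 ?mulr1; first by rewrite /F /C eE eqxx addr0.
  move=> f /negbTE fe; rewrite /F /C fe; case: ifP => _; last by rewrite add0r.
  by rewrite addrC subrK.
rewrite bigA_distr /gnp_prob.
rewrite [RHS](bigID (fun G : {set {set 'I_n}} => (G \subset V) && (e \in G))) /=.
rewrite [X in _ = _ + X]big1 ?addr0; last first.
  move=> G; rewrite negb_and => /orP[/subsetPn[f fG fV]|eG].
    by rewrite (bigD1 f) //= fG /F (negbTE fV) mul0r.
  by rewrite (bigD1 e) //= (negbTE eG) /C eE eqxx mul0r.
apply: eq_big => [G|G]; first by rewrite powersetE.
rewrite powersetE => /andP[GV eG].
rewrite [RHS](bigID (mem V)) /= [X in _ * X]big1 ?mulr1.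
  apply: eq_bigr => f fV; rewrite /F /C fV; case: ifP => // fG.
  by case: eqP fG => // ->; rewrite eG.
move=> f fV; rewrite /C (negbTE fV).
by case: ifP => // /(fintype.subsetP GV); rewrite (negbTE fV).
Qed.

(* Main.v *)
(** Write L = log_{1/(1-p)} n and k = s - 2.  Every K_s-free subgraph H0 of G
    extends to a K_s-saturated one, and only by edges of G whose addition to H0
    creates no K_s.  So it suffices to find H0 with about n L edges that leaves
    only o(n L) edges of G unsaturated; first moments then do the rest.

    Fix disjoint sets A1 (about (1+2e)L/p vertices), A2 (O(L) vertices) and A3
    (O(1) vertices), and let B be the rest.  Let B1 be the vertices of B with
    between (1+e)L and (1+3e)L neighbours in A1, and W = B \ B1, which is
    small by Chebyshev's inequality.  H0 consists of the edges of G between A1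
    and B, A2 and W, A3 and B1, some between A2 and A3, and of K_(k+1)-free
    graphs inside A1, A2 and A3.
    - If every linear-sized subset of A1 contains a K_k of H0, then u in B1 and
      v in B are saturated as soon as they have linearly many common neighbours
      in A1; for a given pair this fails with probability about
      (1-p)^((1+e)L) = n^(-1-e).  Conditioning on the degree of only one end is
      what makes A1 small enough.
    - A2 does the same for pairs inside W, where no degree is guaranteed.
    - A2-B1 pairs would cost O(n L) edges; A3 saturates most of them.  To keep
      H0 free of K_s, A2 is coloured with O(1) colours so that its blocks are
      rainbow, and a vertex of A2 sees only the slots of A3 of its own colour.

    The graphs inside A1 and A2 are of Erdos-Rogers type: unions of the cliques
    of G on the blocks of a k-uniform family which is linear, triangle-free and
    has many blocks inside each dense set.  Such a family is a random one, with
    one block deleted from every short cycle. *)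

Require Import Defs.
From mathcomp Require Import fintype finset.
From mathcomp Require Import zify ring lra.

Set Implicit Arguments.
Unset Strict Implicit.
Unset Printing Implicit Defensive.
Local Open Scope set_scope.
Local Open Scope ring_scope.

(** * Random subsets *)

Section RandomSubset.
Variables (R : realType) (T : finType) (p : R).
Implicit Types (D X G : {set T}) (f g : {set T} -> R).

(** The weight behind [gnp_mass], over an arbitrary ground set, so that one calculus serves random
    graphs and random families of tuples. *)
Definition submass D G : R := \prod_(e in D) (if e \in G then p else 1 - p).

(* Expectation over the random subset of D that contains each element
   independently with probability p. *)
Definition Ex D f : R := \sum_(G in powerset D) submass D G * f G.

(** Independence in its basic form: a random subset of D is the union of independent random subsets
    of X and of its complement in D. *)
Lemma Ex_fubini D X f : X \subset D ->
  Ex D f = Ex X (fun G1 => Ex (D :\: X) (fun G2 => f (G1 :|: G2))).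
Proof.
move=> XD; rewrite /Ex.
under [RHS]eq_bigr => G1 _ do rewrite big_distrr /=.
rewrite pair_big /=.
rewrite [LHS](reindex_onto (fun q => q.1 :|: q.2)
                           (fun G => (G :&: X, G :\: X))) /=; last first.
  by move=> G _; rewrite setID.
apply: eq_big => [[G1 G2]|[G1 G2]] /=.
  rewrite !powersetE xpair_eqE; apply/andP/andP => [[]|[]].
    move=> UD /andP[/eqP G1E /eqP G2E]; split.
      by rewrite -G1E subsetIr.
    by rewrite -G2E setSD.
  move=> G1X; rewrite subsetD => /andP[G2D dis]; split.
    by rewrite subUset G2D (subset_trans G1X).
  rewrite setIUl setDUl (setIidPl G1X) (disjoint_setI0 dis) setU0 eqxx /=.
  have -> : G1 :\: X = set0 by apply/eqP; rewrite setD_eq0.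
  by rewrite set0U; apply/eqP/setDidPl.
move=> /andP[_]; rewrite xpair_eqE => /andP[/eqP G1E /eqP G2E].
rewrite mulrA; congr (_ * _); rewrite /submass.
rewrite (big_setID X) /= (setIidPr XD); congr (_ * _); apply: eq_bigr => e.
  by move=> eX; rewrite -{2}G1E in_setI eX andbT.
by rewrite in_setD => /andP[eX _]; rewrite -{2}G2E in_setD eX.
Qed.

Lemma Ex_set0 f : Ex set0 f = f set0.
Proof. by rewrite /Ex powerset0 big_set1 /submass big_set0 mul1r. Qed.

Lemma Ex_set1 e f : Ex [set e] f = p * f [set e] + (1 - p) * f set0.
Proof.
rewrite /Ex powerset1 big_setU1 /=; last first.
  by rewrite inE eq_sym -cards_eq0 cards1.
by rewrite big_set1 /submass !big_set1 in_set0 in_set1 eqxx addrC.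
Qed.

Lemma Ex_setU1 e D f : e \notin D ->
  Ex (e |: D) f = p * Ex D (fun G => f (e |: G)) + (1 - p) * Ex D f.
Proof.
move=> eD; rewrite (@Ex_fubini _ [set e]) ?subsetUl // Ex_set1.
rewrite setU1K //; congr (_ * _ + _ * _).
by congr (Ex D _); apply/funext => G; rewrite set0U.
Qed.

Lemma eq_Ex D f g : (forall G, G \subset D -> f G = g G) -> Ex D f = Ex D g.
Proof.
by move=> fg; apply: eq_bigr => G; rewrite powersetE => /fg ->.
Qed.

Lemma ExZ D c f : Ex D (fun G => c * f G) = c * Ex D f.
Proof. by rewrite /Ex big_distrr /=; apply: eq_bigr => G _; rewrite mulrCA. Qed.

Lemma Ex_sum (I : Type) (r : seq I) (P : pred I) D (F : I -> {set T} -> R) :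
  Ex D (fun G => \sum_(i <- r | P i) F i G) = \sum_(i <- r | P i) Ex D (F i).
Proof.
by rewrite /Ex exchange_big /=; apply: eq_bigr => G _; rewrite big_distrr.
Qed.

Lemma ExD D f g : Ex D (fun G => f G + g G) = Ex D f + Ex D g.
Proof. by rewrite /Ex -big_split; apply: eq_bigr => G _; rewrite mulrDr. Qed.

Lemma Ex_cst D c : Ex D (fun=> c) = c.
Proof.
move: {2}#|D| (erefl #|D|) => n; elim: n D => [|n IH] D.
  by move/eqP; rewrite cards_eq0 => /eqP ->; rewrite Ex_set0.
move=> Dn; have /set0Pn[e eD] : D != set0 by rewrite -cards_eq0 Dn.
rewrite -(setD1K eD) Ex_setU1 ?setD11 // !IH; first by rewrite -mulrDl addrC subrK mul1r.
all: by move: (cardsD1 e D); rewrite eD Dn => -[].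
Qed.

(** Functions of disjoint sets of coordinates are independent. The last hypothesis says that [F i]
    depends on [X i] only; induction splits off one [X i] at a time. *)
Lemma Ex_prod (I : eqType) (r : seq I) D (X : I -> {set T})
    (F : I -> {set T} -> R) :
  uniq r -> {in r, forall i, X i \subset D} ->
  {in r &, forall i j, i != j -> [disjoint X i & X j]} ->
  {in r, forall i G, F i (G :&: X i) = F i G} ->
  Ex D (fun G => \prod_(i <- r) F i G) = \prod_(i <- r) Ex (X i) (F i).
Proof.
elim: r D => [|i r IH] D /=.
  by under eq_Ex => G _ do rewrite big_nil; rewrite Ex_cst big_nil.
move=> /andP[ir ur] XD Xd FX; rewrite big_cons.
have ii : i \in i :: r by rewrite mem_head.
have rr j : j \in r -> j \in i :: r by rewrite in_cons => ->; rewrite orbT.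
rewrite (@Ex_fubini _ (X i)) ?XD // -(IH (D :\: X i)) //; first last.
- by move=> j /rr; apply: FX.
- by move=> j l /rr jr /rr lr; apply: Xd.
- move=> j jr; rewrite subsetD (XD _ (rr _ jr)) /=.
  by apply: (Xd j i (rr _ jr) ii); apply: contraNneq ir => <-.
rewrite mulrC -ExZ; apply: eq_Ex => G1 G1X; rewrite mulrC -ExZ.
apply: eq_Ex => G2; rewrite subsetD => /andP[_ dis]; rewrite big_cons.
congr (_ * _).
  by rewrite -FX // setIUl (setIidPl G1X) (disjoint_setI0 dis) setU0.
rewrite !big_seq; apply: eq_bigr => j jr.
rewrite -FX ?rr // -[RHS]FX ?rr // setIUl.
suff -> : G1 :&: X j = set0 by rewrite set0U.
apply/disjoint_setI0/(disjointWl G1X)/(Xd i j ii (rr _ jr)).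
by apply: contraNneq ir => ->.
Qed.

Lemma Ex_prod_in (I : finType) (A : {set I}) D (X : I -> {set T})
    (F : I -> {set T} -> R) :
  {in A, forall i, X i \subset D} ->
  {in A &, forall i j, i != j -> [disjoint X i & X j]} ->
  {in A, forall i G, F i (G :&: X i) = F i G} ->
  Ex D (fun G => \prod_(i in A) F i G) = \prod_(i in A) Ex (X i) (F i).
Proof.
move=> XD Xd FX; rewrite -big_enum -(@Ex_prod _ _ D).
- by apply: eq_Ex => G _; rewrite big_enum.
- exact: enum_uniq.
- by move=> i; rewrite mem_enum; apply: XD.
- by move=> i j; rewrite !mem_enum; apply: Xd.
- by move=> i; rewrite mem_enum; apply: FX.
Qed.

Lemma Ex_subset D X : X \subset D -> Ex D (fun G => (X \subset G)%:R) = p ^+ #|X|.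
Proof.
move=> XD; rewrite -prodr_const.
transitivity (Ex D (fun G => \prod_(e in X) ((e \in G)%:R : R))).
  apply: eq_Ex => G _; case: (boolP (X \subset G)) => [XG|].
    by rewrite big1 // => e eX; rewrite (fintype.subsetP XG).
  by case/subsetPn => e eX eG; rewrite (bigD1 e) //= (negbTE eG) mul0r.
rewrite (@Ex_prod_in _ _ _ set1); first last.
- by move=> e _ G; rewrite in_setI in_set1 eqxx andbT.
- by move=> e e' _ _ ee'; rewrite disjoints1 in_set1.
- by move=> e eX; rewrite sub1set (fintype.subsetP XD).
apply: eq_bigr => e _; rewrite Ex_set1 in_set1 in_set0 eqxx.
by rewrite mulr1 mulr0 addr0.
Qed.

Lemma Ex_mem D e : e \in D -> Ex D (fun G => (e \in G)%:R) = p.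
Proof.
move=> eD; rewrite -[RHS]expr1 -(cards1 e) -(@Ex_subset D) ?sub1set //.
by apply: eq_Ex => G _; rewrite sub1set.
Qed.

Hypotheses (p0 : 0 <= p) (p1 : p <= 1).

Lemma submass_ge0 D G : 0 <= submass D G.
Proof. by apply: prodr_ge0 => e _; case: ifP; rewrite // subr_ge0. Qed.

Lemma le_Ex D f g : (forall G, G \subset D -> f G <= g G) -> Ex D f <= Ex D g.
Proof.
move=> fg; apply: ler_sum => G; rewrite powersetE => /fg.
exact/ler_wpM2l/submass_ge0.
Qed.

Lemma Ex_ge0 D f : (forall G, G \subset D -> 0 <= f G) -> 0 <= Ex D f.
Proof. by move=> f0; rewrite -(Ex_cst D 0); apply: le_Ex. Qed.

Lemma Ex_markov D f (c : R) : 0 < c -> (forall G, G \subset D -> 0 <= f G) ->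
  Ex D (fun G => (c < f G)%R%:R) <= Ex D f / c.
Proof.
move=> c0 f0; rewrite mulrC -ExZ; apply: le_Ex => G GD.
case: (boolP (c < f G)) => [cf|_]; last by rewrite mulr_ge0 ?f0 ?invr_ge0 ?ltW.
by rewrite mulrC ler_pdivlMr // mul1r ltW.
Qed.

(** Union bound. *)
Lemma Ex_exists (I : finType) (P : pred I) D (A : I -> pred {set T}) :
  Ex D (fun G => [exists (i | P i), A i G]%:R) <=
  \sum_(i | P i) Ex D (fun G => (A i G)%:R).
Proof.
rewrite -Ex_sum; apply: le_Ex => G _; case: exists_inP => [[i Pi AiG]|_].
  by rewrite (bigD1 i) //= AiG lerDl sumr_ge0.
exact: sumr_ge0.
Qed.

Lemma Ex_lt1_exists D (A : pred {set T}) :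
  Ex D (fun G => (A G)%:R) < 1 -> exists2 G : {set T}, G \subset D & ~~ A G.
Proof.
move=> lt1; apply: contrapT => nex; suff : (1 : R) < 1 by rewrite ltxx.
apply: le_lt_trans lt1; rewrite -{1}(Ex_cst D 1); apply: le_Ex => G GD.
by case: (boolP (A G)) => // nA; case: nex; exists G.
Qed.

End RandomSubset.

(** * Lower tail for the number of disjoint sets that survive *)

Section LowerTail.
Variables (R : realType) (T : finType) (p : R).
Hypotheses (p0 : 0 <= p) (p1 : p <= 1).

(** Exponential moment: give each surviving [X i] the factor 1/2. The product is 2 to the minus the
    number of survivors, so [2 ^+ N] times it dominates the indicator, and by independence its mean
    is a product of factors at most [1 - p ^+ r / 2]. *)
Lemma Ex_lower_tail (I : finType) (B : {set I}) (X : I -> {set T})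
    (D : {set T}) (r N : nat) :
  {in B, forall i, X i \subset D} ->
  {in B &, forall i j, i != j -> [disjoint X i & X j]} ->
  {in B, forall i, #|X i| <= r}%N ->
  Ex p D (fun G => (#|[set i in B | X i \subset G]| < N)%N%:R)
    <= 2 ^+ N * (1 - p ^+ r / 2) ^+ #|B|.
Proof.
move=> XD Xd Xr.
pose F i (G : {set T}) : R := 1 - 2^-1 * (X i \subset G)%:R.
have F_ge i G : 2^-1 <= F i G by rewrite /F; case: (X i \subset G); rewrite ?mulr1 ?mulr0; lra.
apply: (@le_trans _ _ (Ex p D (fun G => 2 ^+ N * \prod_(i in B) F i G))).
  apply: le_Ex => // G GD.
  have -> : \prod_(i in B) F i G = 2^-1 ^+ #|[set i in B | X i \subset G]|.
    rewrite (bigID (fun i => X i \subset G)) /= [X in _ * X]big1 ?mulr1.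
      under eq_bigr => i /andP[_ iG] do rewrite /F iG mulr1.
      rewrite prodr_const; congr (_ ^+ _); first by lra.
      by apply: eq_card => i; rewrite !inE.
    by move=> i /andP[_ /negbTE iG]; rewrite /F iG mulr0 subr0.
  case: ltnP => [lt|_]; last by rewrite mulr_ge0 // exprn_ge0 //; lra.
  rewrite -(subnK (ltnW lt)) exprD -mulrA -exprMn divff ?pnatr_eq0 //.
  by rewrite expr1n mulr1 exprn_ege1 //; lra.
rewrite ExZ ler_wpM2l ?exprn_ge0 //.
rewrite (Ex_prod_in _ XD Xd) => [|i iB G]; last by rewrite /F subsetI subxx andbT.
rewrite -prodr_const; apply: ler_prod => i iB.
rewrite Ex_ge0 //=; last by move=> G _; have := F_ge i G; lra.
rewrite /F; under eq_Ex => G _ do rewrite -mulNr.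
rewrite ExD Ex_cst ExZ Ex_subset // mulNr lerD2l lerN2 mulrC ler_wpM2l ?invr_ge0 //.
by apply: ler_wiXn2l; rewrite ?Xr.
Qed.

End LowerTail.

(** * Sparse rainbow families *)

Lemma leq_card_bigcup (I V : finType) (P : pred I) (F : I -> {set V}) :
  (#|\bigcup_(i | P i) F i| <= \sum_(i | P i) #|F i|)%N.
Proof.
elim/big_rec2: _ => [|i n B _ IH]; first by rewrite cards0.
by apply: leq_trans (leq_card_setU _ _) _; rewrite leq_add2l.
Qed.

(** A function with at most r values factors as a list of r values in A after a map from J to
    ['I_r]. *)
Lemma card_small_range (J V : finType) (A : {set V}) (r : nat) : (0 < #|J|)%N ->
  (#|[set F : {ffun J -> V} | (F \in ffun_on (mem A)) && (#|F @: setT| <= r)%N]|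
     <= #|A| ^ r * r ^ #|J|)%N.
Proof.
move=> /card_gt0P[j0 _].
pose X := setX [set h : {ffun 'I_r -> V} | h \in ffun_on (mem A)]
               [set: {ffun J -> 'I_r}].
pose comp (q : {ffun 'I_r -> V} * {ffun J -> 'I_r}) := [ffun j => q.1 (q.2 j)].
have cX : #|X| = (#|A| ^ r * r ^ #|J|)%N.
  rewrite cardsX cardsT card_ffun card_ord; congr (_ * _)%N.
  by rewrite -[X in (_ ^ X)%N]card_ord -card_ffun_on; apply: eq_card => h; rewrite inE.
rewrite -cX; apply: leq_trans (leq_imset_card comp X); apply: subset_leq_card.
apply/fintype.subsetP => F; rewrite inE => /andP[/ffun_onP FA Fr].
pose U := enum (F @: setT).
have idx j : (index (F j) U < r)%N.
  by apply: leq_trans Fr; rewrite cardE index_mem mem_enum imset_f.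
(* The value [F j0] fills the indices beyond the range of F; this is where J must be nonempty. *)
apply/imsetP; exists ([ffun i : 'I_r => nth (F j0) U i],
                     [ffun j => Ordinal (idx j)]).
  rewrite inE /= in_setT andbT inE; apply/ffun_onP => i; rewrite ffunE.
  have [iU|iU] := ltnP i (size U); last by rewrite nth_default ?FA.
  have := mem_nth (F j0) iU; rewrite mem_enum => /imsetP[j _ ->]; exact: FA.
apply/ffunP => j; rewrite !ffunE /= nth_index // mem_enum.
exact: imset_f.
Qed.

Section Rainbow.
Variables (V : finType) (c : V -> nat) (k : nat).

(** Blocks are first handled as ordered tuples, which turns counting blocks into counting functions.
    Distinct colours make such a tuple injective. *)
Definition rainbow (A : {set V}) : {set {ffun 'I_k -> V}} :=
  [set f : {ffun 'I_k -> V} | (f \in ffun_on (mem A)) &&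
     [forall i, forall j, (i != j) ==> (c (f i) != c (f j))]].

(** Choose the entry at i in |S| ways; then the entry at j lies in a colour class of at most w
    vertices, and the other k - 2 entries are free. *)
Lemma card_monochrome (S : {set V}) (w : nat) (i j : 'I_k) : i != j ->
  (forall t, #|[set x in S | c x == t]| <= w)%N ->
  (#|[set f : {ffun 'I_k -> V} | (f \in ffun_on (mem S)) && (c (f i) == c (f j))]|
     <= w * #|S| ^ k.-1)%N.
Proof.
move=> ij wP; pose E := [set f : {ffun 'I_k -> V} | (f \in ffun_on (mem S)) &&
                           (c (f i) == c (f j))].
pose F v (l : 'I_k) : {set V} := if l == j then [set x in S | c x == c v]
                       else if l == i then [set v] else S.
have card_F v : (#|family (fun l => mem (F v l))| <= w * #|S| ^ k.-2)%N.
  rewrite card_family foldrE big_map big_enum /=.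
  rewrite (bigD1 j) //= (bigD1 i) //= {1 2}/F !eqxx (negbTE ij) cards1 mul1n.
  rewrite leq_mul ?wP // leq_eqVlt; apply/orP; left; apply/eqP.
  under eq_bigr => l /andP[lj li] do rewrite /F (negbTE lj) (negbTE li).
  rewrite prod_nat_const; congr (_ ^ _)%N.
  have kE : k = #|[predC (pred2 i j)]|.+2.
    by rewrite -[LHS]card_ord -(cardC (pred2 i j)) card2 ij.
  have -> : #|[pred l | (l != j) && (l != i)]| = #|[predC (pred2 i j)]|.
    by apply: eq_card => l; rewrite !inE negb_or andbC.
  by rewrite [in RHS]kE.
have k2 : (1 < k)%N.
  by have := max_card (pred2 i j); rewrite card2 ij card_ord.
rewrite -/E; have -> : (w * #|S| ^ k.-1 = \sum_(v in S) w * #|S| ^ k.-2)%N.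
  by rewrite sum_nat_const mulnCA -expnS; congr (_ * _ ^ _)%N; lia.
apply: leq_trans (_ : \sum_(v in S) #|family (fun l => mem (F v l))| <= _)%N; last first.
  by apply: leq_sum => v _.
apply: leq_trans (_ : #|\bigcup_(v in S) [set f in family (fun l => mem (F v l))]| <= _)%N.
  apply/subset_leq_card/fintype.subsetP => f; rewrite inE => /andP[/ffun_onP fS cf].
  apply/bigcupP; exists (f i); rewrite ?fS // inE; apply/familyP => l.
  rewrite /F; case: eqP => [->|_]; first by rewrite !inE fS eq_sym.
  by case: eqP => [->|_]; rewrite ?inE ?fS.
apply: leq_trans (leq_card_bigcup _ _) _.
by apply: leq_sum => v _; rewrite cardsE.
Qed.

(** Each of at most k^2 pairs of positions spoils at most w |S|^(k-1) tuples, in total at most half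
    of all tuples. *)
Lemma card_rainbow (S : {set V}) (w : nat) :
  (forall t, #|[set x in S | c x == t]| <= w)%N -> (2 * k ^ 2 * w <= #|S|)%N ->
  (0 < k)%N -> (#|S| ^ k <= 2 * #|rainbow S|)%N.
Proof.
move=> wP wS k0.
have cS : #|[set f : {ffun 'I_k -> V} | f \in ffun_on (mem S)]| = (#|S| ^ k)%N.
  by rewrite cardsE card_ffun_on card_ord.
have : (#|S| ^ k <= #|rainbow S| + k ^ 2 * (w * #|S| ^ k.-1))%N.
  rewrite -cS.
  pose E (q : 'I_k * 'I_k) := [set f : {ffun 'I_k -> V} |
     (f \in ffun_on (mem S)) && (c (f q.1) == c (f q.2))].
  apply: leq_trans (_ : #|rainbow S :|: \bigcup_(q | q.1 != q.2) E q| <= _)%N.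
    apply/subset_leq_card/fintype.subsetP => f; rewrite in_set => fS; rewrite in_setU in_set fS /=.
    case: (boolP [forall _, _]) => //= /forallPn[i /forallPn[j]].
    rewrite negb_imply negbK => /andP[ij cij].
    by apply/bigcupP; exists (i, j); rewrite // in_set fS.
  apply: leq_trans (leq_card_setU _ _) _; rewrite leq_add2l.
  apply: leq_trans (leq_card_bigcup _ _) _.
  apply: leq_trans (_ : \sum_(q : 'I_k * 'I_k) w * #|S| ^ k.-1 <= _)%N.
    rewrite big_mkcond; apply: leq_sum => q _.
    by case: ifP => // q12; apply: card_monochrome.
  by rewrite sum_nat_const card_prod card_ord -mulnn.
have -> : (#|S| ^ k = #|S| * #|S| ^ k.-1)%N by rewrite -expnS prednK.
by move: wS; set P := (#|S| ^ k.-1)%N; set K := (k ^ 2)%N; nia.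
Qed.

End Rainbow.

(** * Short cycles in a random family and their deletion *)

Section Crowded.
Variables (V : finType) (k : nat).
Implicit Types D E : {set {ffun 'I_k -> V}}.

Definition member_of j (F : {ffun 'I_j * 'I_k -> V}) (i : 'I_j) :
  {ffun 'I_k -> V} := [ffun l => F (i, l)].

(* j distinct k-tuples of D, merged into one function, that together span at
   most j(k-1) points.  If each k-tuple on a points is kept with probability of
   order a^(1-k), then only O(1) such configurations are expected. *)
Definition crowded j D : {set {ffun 'I_j * 'I_k -> V}} :=
  [set F : {ffun 'I_j * 'I_k -> V} | [&& [forall i, member_of F i \in D],
     injectiveb (member_of F) & (#|F @: setT| <= j * k.-1)%N]].

Lemma crowdedS j D E : D \subset E -> crowded j D \subset crowded j E.
Proof.
move=> DE; apply/fintype.subsetP => F; rewrite !inE => /and3P[/forallP FD -> ->].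
by rewrite !andbT; apply/forallP => i; rewrite (fintype.subsetP DE).
Qed.

Lemma card_crowded j D (A : {set V}) : (0 < j)%N -> (0 < k)%N ->
  (forall f, f \in D -> f \in ffun_on (mem A)) ->
  (#|crowded j D| <= #|A| ^ (j * k.-1) * (j * k.-1) ^ (j * k))%N.
Proof.
move=> j0 k0 DA.
have := @card_small_range ('I_j * 'I_k)%type V A (j * k.-1).
rewrite card_prod !card_ord muln_gt0 j0 k0 => /(_ isT).
apply: leq_trans; apply/subset_leq_card/fintype.subsetP => F.
rewrite !in_set => /and3P[/forallP FD _ ->]; rewrite andbT.
by apply/ffun_onP => -[i l]; have /DA/ffun_onP/(_ l) := FD i; rewrite ffunE.
Qed.

(** A configuration consists of j distinct tuples, so it survives with probability q^j; sum over all
    configurations. *)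
Lemma Ex_crowded (R : realType) (q : R) j D :
  Ex q D (fun E => #|crowded j E|%:R) = #|crowded j D|%:R * q ^+ j.
Proof.
pose M (F : {ffun 'I_j * 'I_k -> V}) := [set member_of F i | i : 'I_j].
transitivity (Ex q D (fun E => \sum_(F in crowded j D) ((M F \subset E)%:R : R))).
  apply: eq_Ex => E ED; rewrite -sum1_card natr_sum /=.
  rewrite [RHS](bigID (mem (crowded j E))) /= [X in _ = _ + X]big1 ?addr0.
    apply: eq_big => [F|F FE].
      by case: (boolP (F \in crowded j E)) => FE;
        rewrite ?andbF // (fintype.subsetP (crowdedS _ ED)).
    suff -> : M F \subset E by [].
    apply/fintype.subsetP => _ /imsetP[i _ ->].
    by move: FE; rewrite inE => /and3P[/forallP].
  move=> F /andP[FD FE]; case: (boolP (M F \subset E)) => // ME; case/negP: FE.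
  move: FD; rewrite !inE => /and3P[_ -> ->]; rewrite !andbT.
  by apply/forallP => i; apply: (fintype.subsetP ME); apply: imset_f.
rewrite Ex_sum mulr_natl -sumr_const; apply: eq_bigr => F.
rewrite inE => /and3P[/forallP FD /injectiveP Fi _].
rewrite Ex_subset; first by rewrite card_imset // card_ord.
by apply/fintype.subsetP => _ /imsetP[i _ ->].
Qed.

(** Removes the first tuple of every configuration; the index [j.+1] guarantees that there is a
    first one. *)
Definition uncrowd j D : {set {ffun 'I_k -> V}} :=
  D :\: [set member_of F ord0 | F in crowded j.+1 D].

Lemma crowded_uncrowd j D : crowded j.+1 (uncrowd j D) = set0.
Proof.
apply/setP => F; rewrite in_set0; apply/negbTE/negP => FU.
have FD : F \in crowded j.+1 D by apply: (fintype.subsetP (crowdedS _ (subsetDl _ _))) FU.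
move: FU; rewrite inE => /and3P[/forallP/(_ ord0)].
by rewrite in_setD => /andP[/negP[]]; apply: imset_f.
Qed.

Lemma card_uncrowd j D E :
  (#|D :&: E| <= #|uncrowd j D :&: E| + #|crowded j.+1 D|)%N.
Proof.
rewrite /uncrowd; set X := [set _ | _ in _].
have Xc : (#|X| <= #|crowded j.+1 D|)%N by apply: leq_imset_card.
apply: leq_trans (leq_add (leqnn _) Xc).
apply: leq_trans (leq_card_setU _ _); apply/subset_leq_card/fintype.subsetP => f.
by rewrite !in_setU !in_setI in_setD; case: (f \in X); rewrite ?orbT ?orbF.
Qed.

End Crowded.

(** Deletion method. Keep each rainbow tuple on A with probability q of order a^(1-k), where a =
    |A|. A dense set then keeps a large multiple of a tuples, except with a probability small enough
    for a union bound over 2^a subsets, while only O(1) crowded pairs and triples are expected;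
    their removal costs at most C a tuples. *)
Lemma exists_sparse_rainbow (R : realType) (k C : nat) (gam : R) :
  (2 <= k)%N -> (0 < C)%N -> 0 < gam ->
  exists a0, forall (V : finType) (A : {set V}) (c : V -> nat) (w : nat),
  (a0 <= #|A|)%N -> (forall t, #|[set x in A | c x == t]| <= w)%N ->
  (2 * k ^ 2 * w)%N%:R <= gam * #|A|%:R ->
  exists E : {set {ffun 'I_k -> V}},
    [/\ E \subset rainbow c k A, crowded 2 E = set0, crowded 3 E = set0 &
        forall S : {set V}, S \subset A -> gam * #|A|%:R <= #|S|%:R ->
          (C * #|A| <= #|E :&: rainbow c k S|)%N].
Proof.
move=> k2 C0 gam0.
(* With this M a dense set keeps at least 2 (2C + 2) a tuples on average; [K j] will bound the
   expected number of crowded j-configurations. *)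
pose M : R := 4 * (2 * C + 2)%:R / gam ^+ k.
have M0 : 0 < M by rewrite divr_gt0 ?exprn_gt0 // mulr_gt0 // ltr0n; lia.
pose K j : R := ((j * k.-1) ^ (j * k))%N%:R * M ^+ j.
have K0 j : 0 <= K j by rewrite mulr_ge0 // exprn_ge0 // ltW.
(* Large enough for q <= 1, for fewer than a/4 expected crowded configurations, and for 2 <= a. *)
exists (Num.truncn (M + 4 * (K 2 + K 3))).+2 => V A c w a_ge cA wA.
set a := #|A| in a_ge wA *.
have aM : M + 4 * (K 2%N + K 3%N) < a%:R.
  by apply: lt_trans (truncnS_gt _) _; rewrite ltr_nat.
have a2 : (2 <= a)%N by apply: leq_trans a_ge.
have a1 : (a < 2 * a)%N by lia.
have K2 := K0 2%N; have K3 := K0 3%N.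
have aR0 : 0 < a%:R :> R by rewrite ltr0n; lia.
have aR1 : 1 <= a%:R :> R by rewrite ler1n; lia.
pose q : R := M / a%:R ^+ k.-1.
have q0 : 0 < q by rewrite divr_gt0 ?exprn_gt0.
have q1 : q <= 1.
  rewrite ler_pdivrMr ?exprn_gt0 // mul1r; apply: (@le_trans _ _ a%:R); first lra.
  by rewrite -[leLHS]expr1; apply: ler_weXn2l => //; lia.
have qk : a%:R ^+ k * q = a%:R * M.
  rewrite /q -[in LHS](prednK (ltnW k2)) exprS; field.
  by rewrite expf_neq0 ?gt_eqF.
pose D := rainbow c k A.
(* Twice the required number of tuples is demanded here: the surplus C a pays for the deletions. *)
pose few (E : {set {ffun 'I_k -> V}}) := [exists (S : {set V} |
  (S \subset A) && (gam * a%:R <= #|S|%:R)), (#|E :&: rainbow c k S| < 2 * C * a)%N].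
pose many (E : {set {ffun 'I_k -> V}}) :=
  ((C * a)%N%:R < #|crowded 2 E|%:R + #|crowded 3 E|%:R :> R).
have few_le : Ex q D (fun E => (few E)%:R) <= 2^-1.
  apply: (@le_trans _ _ (\sum_(S : {set V} | (S \subset A) && (gam * a%:R <= #|S|%:R))
     Ex q D (fun E => (#|E :&: rainbow c k S| < 2 * C * a)%N%:R))).
    by apply: Ex_exists => //; exact: ltW.
  apply: (@le_trans _ _ (\sum_(S in powerset A) 2^-1 ^+ a.+1)).
    rewrite big_mkcond [leRHS]big_mkcond; apply: ler_sum => S _.
    rewrite powersetE; case: (boolP (S \subset A)) => //= SA.
    case: ifP => [aS|_]; last by rewrite exprn_ge0 ?invr_ge0.
    have Sw : (#|S| ^ k <= 2 * #|rainbow c k S|)%N.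
      apply: (@card_rainbow _ _ _ _ w); last exact: ltnW.
        by move=> t; apply: leq_trans (cA t);
          apply/subset_leq_card/fintype.subsetP => x;
          rewrite !inE => /andP[/(fintype.subsetP SA) -> ->].
      by rewrite -(ler_nat R); apply: le_trans aS.
    set Q := rainbow c k S in Sw *.
    have QD : Q \subset D.
      apply/fintype.subsetP => f; rewrite !in_set => /andP[/ffun_onP fS ->].
      by rewrite andbT; apply/ffun_onP => i; apply: (fintype.subsetP SA); apply: fS.
    apply: (@le_trans _ _ (2 ^+ (2 * C * a) * (1 - q / 2) ^+ #|Q|)).
      rewrite -[X in X / 2]expr1.
      rewrite (@eq_Ex _ _ _ _ _
          (fun E => (#|[set f in Q | [set f] \subset E]| < 2 * C * a)%N%:R)); last first.
        move=> E _; rewrite (_ : [set f in Q | [set f] \subset E] = E :&: Q) //.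
        by apply/setP => f; rewrite in_set in_setI sub1set andbC.
      apply: Ex_lower_tail; rewrite // ?(ltW q0) //.
      - by move=> f fQ; rewrite sub1set (fintype.subsetP QD).
      - by move=> f g _ _ fg; rewrite disjoints1 in_set1.
      - by move=> f _; rewrite cards1.
    have NQ : (2 * C + 2)%N%:R * a%:R <= #|Q|%:R * (q / 2).
      have : (gam * a%:R) ^+ k <= 2 * #|Q|%:R.
        apply: (@le_trans _ _ (#|S|%:R ^+ k)).
          by rewrite lerXn2r ?nnegrE ?mulr_ge0 // ltW.
        by rewrite -natrX -natrM ler_nat.
      rewrite exprMn => /(ler_wpM2r (ltW q0)); rewrite -mulrA qk.
      rewrite (_ : gam ^+ k * (a%:R * M) = 4 * ((2 * C + 2)%:R * a%:R)); first by lra.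
      by rewrite /M; field; rewrite expf_neq0 ?gt_eqF.
    have e2 : (1 - q / 2) ^+ #|Q| <= 2^-1 ^+ ((2 * C + 2) * a).
      apply: (@le_trans _ _ (expR (- (q / 2)) ^+ #|Q|)).
        by rewrite lerXn2r ?nnegrE ?expR_ge0 //; [lra | exact: expR_ge1Dx].
      rewrite -expRM_natl mulrN.
      apply: (@le_trans _ _ (expR (- ((2 * C + 2) * a)%N%:R))).
        by rewrite ler_expR lerN2 natrM.
      rewrite -[X in - X]mulr1 -mulrN expRM_natl.
      rewrite lerXn2r ?nnegrE ?expR_ge0 ?invr_ge0 // expRN.
      rewrite lef_pV2 ?posrE ?expR_gt0 //.
      by have := @expR_ge1Dx R 1; lra.
    (* What remains is 4^(-a), at most 2^(-a-1), which leaves 1/2 after summing over all subsets of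
       A. *)
    apply: (@le_trans _ _ (2 ^+ (2 * C * a) * 2^-1 ^+ ((2 * C + 2) * a))).
      by rewrite ler_wpM2l ?exprn_ge0.
    rewrite mulnDl exprD mulrA -exprMn divff ?pnatr_eq0 // expr1n mul1r.
    by apply: ler_wiXn2l => //; rewrite invf_le1 ?ler1n.
  rewrite sumr_const card_powerset -/a -[X in X <= _]mulr_natl natrX exprS mulrCA.
  by rewrite -exprMn divff ?pnatr_eq0 // expr1n mulr1.
have many_lt : Ex q D (fun E => (many E)%:R) < 2^-1.
  have Ca0 : 0 < (C * a)%N%:R :> R by rewrite ltr0n muln_gt0 C0; lia.
  apply: le_lt_trans (Ex_markov (ltW q0) q1 Ca0 _) _ => [E _|].
    by rewrite addr_ge0.
  rewrite ExD !Ex_crowded ltr_pdivrMr //.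
  have KD j : (0 < j)%N -> #|crowded j D|%:R * q ^+ j <= K j.
    move=> j0; apply: (@le_trans _ _ ((a ^ (j * k.-1) * (j * k.-1) ^ (j * k))%N%:R * q ^+ j)).
      rewrite ler_wpM2r ?(exprn_ge0 _ (ltW q0)) // ler_nat.
      apply: card_crowded => //; first exact: ltnW.
      by move=> f; rewrite in_set => /andP[].
    have aq : a%:R ^+ k.-1 * q = M by rewrite mulrC divfK // expf_neq0 ?gt_eqF.
    by rewrite /K natrM mulrAC natrX mulnC exprM -exprMn aq mulrC.
  have := KD 2%N isT; have := KD 3%N isT.
  have : a%:R <= (C * a)%N%:R :> R by rewrite ler_nat; nia.
  by lra.
have [E ED] : exists2 E : {set {ffun 'I_k -> V}}, E \subset D & ~~ (few E || many E).
  apply: (@Ex_lt1_exists R _ q (ltW q0) q1).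
  apply: (@le_lt_trans _ _ (Ex q D (fun E => (few E)%:R + (many E)%:R))).
    apply: le_Ex => //; first exact: ltW.
    by move=> E _; case: (few E); case: (many E); rewrite /= ?addr0 ?add0r ?lerDl.
  by rewrite ExD; lra.
rewrite negb_or => /andP[nfew]; rewrite /many -leNgt -natrD ler_nat => nmany.
(* Pairs are destroyed first, then triples; deleting tuples never creates a crowded
   configuration. *)
pose E2 := uncrowd 1 E; pose E3 := uncrowd 2 E2.
have E3E2 : E3 \subset E2 by apply: subsetDl.
have E2E : E2 \subset E by apply: subsetDl.
exists E3; split.
- by apply: subset_trans ED; apply: subset_trans E2E.
- by apply/eqP; rewrite -subset0 -(crowded_uncrowd 1 E); apply: crowdedS.
- exact: crowded_uncrowd.
move=> S SA aS.
have arith n x2 x3 y3 e e2 e3 : (x2 + x3 <= n -> 2 * n <= e -> y3 <= x3 ->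
    e2 <= e3 + y3 -> e <= e2 + x2 -> n <= e3)%N by clear; lia.
apply: arith nmany _ (subset_leq_card (@crowdedS V k 3 _ _ E2E))
  (card_uncrowd 2 E2 (rainbow c k S)) (card_uncrowd 1 E (rainbow c k S)).
rewrite mulnA leqNgt; apply: contra nfew => lt; apply/exists_inP.
by exists S; rewrite ?SA.
Qed.

(** * Block systems *)

Lemma exists_expr_le (R : realType) (x y : R) : 0 <= x -> x < 1 -> 0 < y ->
  exists2 C : nat, (0 < C)%N & x ^+ C <= y.
Proof.
move=> x0 x1 y0; pose z := (y * (1 - x))^-1.
have z0 : 0 < z by rewrite invr_gt0 mulr_gt0 // subr_gt0.
exists (Num.truncn z).+1 => //; set C := (Num.truncn z).+1.
have zC : z < C%:R by apply: truncnS_gt.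
apply: (@le_trans _ _ (expR (- (1 - x)) ^+ C)).
  by rewrite lerXn2r ?nnegrE ?expR_ge0 //; have := @expR_ge1Dx R (- (1 - x)); lra.
rewrite -expRM_natl mulrN expRN -[leRHS]invrK lef_pV2 ?posrE ?expR_gt0 ?invr_gt0 //.
apply: le_trans (expR_ge1Dx _).
have -> : y^-1 = z * (1 - x).
  by rewrite /z invfM mulfVK // subr_eq0 gt_eqF.
have : z * (1 - x) <= C%:R * (1 - x) by apply: ler_wpM2r; rewrite ?subr_ge0 ltW.
by lra.
Qed.

Section Blocks.
Variable V : finType.

Definition edges_in (Q : {set V}) : {set {set V}} := [set e in vpairs V | e \subset Q].

Definition joined (L : {set {set V}}) (x y : V) : bool :=
  [exists Q in L, (x \in Q) && (y \in Q)].

(** In graph terms: the union of the complete graphs on the blocks is K_(k+1)-free. *)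
Definition clique_bound (k : nat) (L : {set {set V}}) : Prop :=
  forall K : {set V}, {in K &, forall x y, x != y -> joined L x y} -> (#|K| <= k)%N.

Lemma card_edges_in (Q : {set V}) : (#|edges_in Q| <= 2 ^ #|Q|)%N.
Proof.
rewrite -card_powerset; apply/subset_leq_card/fintype.subsetP => e.
by rewrite powersetE inE => /andP[].
Qed.

(** Turns the absence of crowded configurations into a lower bound for the span of j distinct
    tuples. *)
Lemma uncrowded_span (k j : nat) (E : {set {ffun 'I_k -> V}})
    (t : j.-tuple {ffun 'I_k -> V}) (U : {set V}) :
  crowded j E = set0 -> uniq t -> {in t, forall f, f \in E} ->
  {in t, forall f : {ffun 'I_k -> V}, f @: setT \subset U} -> (j * k.-1 < #|U|)%N.
Proof.
move=> E0 /tuple_uniqP t_inj tE tU; rewrite ltnNge; apply/negP => Uj.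
pose F : {ffun 'I_j * 'I_k -> V} := [ffun q => tnth t q.1 q.2].
have FE i : member_of F i = tnth t i by apply/ffunP => l; rewrite !ffunE.
suff : F \in crowded j E by rewrite E0 in_set0.
rewrite inE; apply/and3P; split.
- by apply/forallP => i; rewrite FE tE ?mem_tnth.
- by apply/injectiveP => i i'; rewrite !FE; apply: t_inj.
apply: leq_trans Uj; apply/subset_leq_card/fintype.subsetP => _ /imsetP[[i l] _ ->].
by rewrite ffunE; apply: (fintype.subsetP (tU _ (mem_tnth i t))); apply: imset_f.
Qed.

Section Sparse.
Variables (k : nat) (E : {set {ffun 'I_k -> V}}).
Hypotheses (k2 : (2 <= k)%N) (E_inj : {in E, forall f : {ffun 'I_k -> V}, injective f}).
Hypotheses (E2 : crowded 2 E = set0) (E3 : crowded 3 E = set0).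

Let card_im f : f \in E -> #|f @: setT| = k.
Proof. by move=> fE; rewrite card_imset ?cardsT ?card_ord //; apply: E_inj. Qed.

(** Two blocks with two common points would span at most 2(k - 1) points. *)
Lemma sparse_linear f g : f \in E -> g \in E -> f != g ->
  (#|f @: setT :&: g @: setT| <= 1)%N.
Proof.
move=> fE gE fg.
have := @uncrowded_span k 2 E [tuple f; g] (f @: setT :|: g @: setT) E2.
rewrite /= inE fg => /(_ isT); rewrite cardsU !card_im //.
have tE : {in [:: f; g], forall h, h \in E} by move=> h; rewrite !inE => /orP[] /eqP ->.
have tU : {in [:: f; g], forall h : {ffun 'I_k -> V},
    h @: setT \subset f @: setT :|: g @: setT}.
  by move=> h; rewrite !inE => /orP[] /eqP ->; rewrite ?subsetUl ?subsetUr.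
move=> /(_ tE tU); have := subset_leq_card (subsetIl (f @: setT) (g @: setT)).
by rewrite card_im //; move: #|_| => n; clear - k2; lia.
Qed.

(** A clique on more than k points has points x, y in one block f and a point z outside f. The
    blocks g through x, z and h through y, z are either equal, and then meet f twice, or form with f
    a triangle that spans at most 3(k - 1) points. *)
Lemma sparse_clique_bound : clique_bound k [set f @: setT | f : {ffun 'I_k -> V} in E].
Proof.
move=> K Kj; rewrite leqNgt; apply/negP => kK.
have blk x y : x \in K -> y \in K -> x != y ->
    exists2 f : {ffun 'I_k -> V}, f \in E & (x \in f @: setT) && (y \in f @: setT).
  by move=> xK yK /(Kj _ _ xK yK)/exists_inP[_ /imsetP[f fE ->] ?]; exists f.
have /card_gt1P[x [y [xK yK xy]]] : (1 < #|K|)%N by apply: ltn_trans kK.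
have [f fE /andP[xf yf]] := blk _ _ xK yK xy.
have /subsetPn[z zK zf] : ~~ (K \subset f @: setT).
  by apply: contraL kK => /subset_leq_card; rewrite card_im // -leqNgt.
have xz : x != z by apply: contraNneq zf => <-.
have yz : y != z by apply: contraNneq zf => <-.
have [g gE /andP[xg zg]] := blk _ _ xK zK xz.
have [h hE /andP[yh zh]] := blk _ _ yK zK yz.
have fg : f != g by apply: contraNneq zf => ->.
have fh : f != h by apply: contraNneq zf => ->.
have [gh|gh] := eqVneq g h.
  have := sparse_linear fE gE fg; rewrite leqNgt => /negP[]; apply/card_gt1P.
  by exists x, y; rewrite !in_setI xf yf xg gh yh.
pose U := f @: setT :|: g @: setT :|: h @: setT.
have : (3 * k.-1 < #|U|)%N.
  apply: (@uncrowded_span k 3 E [tuple f; g; h]) => //=.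
  - by rewrite !inE negb_or fg fh gh.
  - by move=> u; rewrite !inE => /or3P[] /eqP ->.
  move=> u; rewrite /U !inE => /or3P[] /eqP ->; last exact: subsetUr.
    by rewrite -setUA subsetUl.
  by rewrite setUAC subsetUr.
rewrite /U cardsU card_im // [X in (_ < X + _ - _)%N]cardsU !card_im //.
have fg1 : (0 < #|f @: setT :&: g @: setT|)%N.
  by apply/card_gt0P; exists x; rewrite in_setI xf.
have fgh : (1 < #|(f @: setT :|: g @: setT) :&: h @: setT|)%N.
  by apply/card_gt1P; exists y, z; rewrite !in_setI !in_setU yf yh zg zh orbT.
by move: fg1 fgh; move: #|_| #|_| => n m; clear - k2; lia.
Qed.

(** Linearity again; it makes the events that G is complete on the various blocks independent. *)
Lemma sparse_disjoint f g : f \in E -> g \in E -> f != g ->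
  [disjoint edges_in (f @: setT) & edges_in (g @: setT)].
Proof.
move=> fE gE fg; rewrite -setI_eq0; apply/eqP/setP => e; rewrite !inE.
apply/negbTE/negP => /andP[/andP[/eqP e2 ef] /andP[_ eg]].
have := sparse_linear fE gE fg; rewrite leqNgt -e2 => /negP[].
by apply: subset_leq_card; rewrite subsetI ef.
Qed.

End Sparse.
End Blocks.

(** Take the sparse rainbow family with a large C. A dense set contains at least C a blocks, on each
    of which G is complete independently and with probability bounded below, so all of them fail
    with probability exponentially small in a; a union bound over dense sets finishes. *)
Lemma exists_blocks (R : realType) (p : R) (k : nat) (gam eps : R) :
  0 < p -> p < 1 -> (0 < k)%N -> 0 < gam -> 0 < eps ->
  exists a0, forall (V : finType) (A : {set V}) (c : V -> nat) (w : nat),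
  (a0 <= #|A|)%N -> (forall t, #|[set x in A | c x == t]| <= w)%N ->
  (2 * k ^ 2 * w)%N%:R <= gam * #|A|%:R ->
  exists L : {set {set V}},
    [/\ forall Q, Q \in L -> [/\ Q \subset A, #|Q| = k & {in Q &, injective c}],
        clique_bound k L &
        Ex p (vpairs V) (fun G => [exists (S : {set V} |
            (S \subset A) && (gam * #|A|%:R <= #|S|%:R)),
          ~~ [exists Q in L, (Q \subset S) && (edges_in Q \subset G)]]%:R) <= eps].
Proof.
move=> p0 p1 k0 gam0 eps0.
(* For k = 1 the singletons serve as blocks: they contain no pair, so every nonempty set has a
   complete block. *)
have [k2|] := ltnP 1 k; last first.
  rewrite leq_eqVlt ltnNge k0 orbF => /eqP ->; exists 1%N => V A c w A1 _ _.
  exists [set [set x] | x in A]; split.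
  - move=> _ /imsetP[x xA ->]; rewrite sub1set xA cards1; split=> // y z.
    by rewrite !inE => /eqP -> /eqP ->.
  - move=> K Kj; rewrite leqNgt; apply/negP => /card_gt1P[x [y [xK yK xy]]].
    have /exists_inP[_ /imsetP[z _ ->]] := Kj _ _ xK yK xy.
    by rewrite !inE => /andP[/eqP xz /eqP yz]; rewrite xz yz eqxx in xy.
  rewrite (@eq_Ex _ _ _ _ _ (fun=> 0)) ?Ex_cst ?ltW // => G _.
  case: exists_inP => // -[S /andP[SA aS] /exists_inP[]].
  have /card_gt0P[x xS] : (0 < #|S|)%N.
    by rewrite -(ltr_nat R); apply: lt_le_trans aS; rewrite mulr_gt0 // ltr0n.
  exists [set x]; first by apply: imset_f; apply: (fintype.subsetP SA).
  rewrite sub1set xS; apply/fintype.subsetP => e; rewrite !inE => /andP[/eqP e2].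
  by move/subset_leq_card; rewrite e2 cards1.
pose del : R := p ^+ (2 ^ k) / 2.
have del0 : 0 < del by rewrite divr_gt0 ?exprn_gt0.
have del1 : del < 1.
  have : p ^+ (2 ^ k) <= 1 by rewrite exprn_ile1 ?ltW.
  by rewrite /del; lra.
(* The failure probability 4^(-a) beats the 2^a subsets, and the remaining 2^(-a) is small once a >=
   [a1]. *)
have [C C0 CP] : exists2 C : nat, (0 < C)%N & (1 - del) ^+ C <= 4^-1.
  by apply: exists_expr_le; rewrite ?invr_gt0; lra.
have [a1 _ a1P] : exists2 C : nat, (0 < C)%N & (2^-1 : R) ^+ C <= eps / 2.
  by apply: exists_expr_le; lra.
have [a0 a0P] := exists_sparse_rainbow k2 C0 gam0.
exists (maxn a0 a1) => V A c w; rewrite geq_max => /andP[aA a1A] cA wA.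
have [E [EA E2 E3 EC]] := a0P V A c w aA cA wA.
have E_c f : f \in E -> injective (c \o f).
  move=> /(fintype.subsetP EA); rewrite in_set => /andP[_ /forallP fr] i j /= cij.
  apply: contrapT => /eqP ij; move/forallP: (fr i) => /(_ j).
  by rewrite ij cij eqxx.
have E_inj : {in E, forall f : {ffun 'I_k -> V}, injective f}.
  by move=> f /E_c fi i j fij; apply: fi; rewrite /= fij.
exists [set f @: setT | f : {ffun 'I_k -> V} in E]; split.
- move=> _ /imsetP[f fE ->]; rewrite card_imset ?cardsT ?card_ord; last exact: E_inj.
  split=> //; last first.
    by move=> _ _ /imsetP[i _ ->] /imsetP[j _ ->] cij; rewrite (E_c _ fE i j cij).
  apply/fintype.subsetP => _ /imsetP[i _ ->].
  by move/(fintype.subsetP EA): fE; rewrite in_set => /andP[/ffun_onP].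
- exact: sparse_clique_bound.
set a := #|A| in a1A EC *.
apply: le_trans (Ex_exists (ltW p0) (ltW p1) _ _ _) _.
apply: (@le_trans _ _ (\sum_(S in powerset A) 2 * 4^-1 ^+ a)).
  rewrite big_mkcond [leRHS]big_mkcond; apply: ler_sum => S _.
  rewrite powersetE; case: (boolP (S \subset A)) => //= SA.
  case: ifP => [aS|_]; last by rewrite mulr_ge0 // exprn_ge0 ?invr_ge0.
  set B := E :&: rainbow c k S.
  pose X (f : {ffun 'I_k -> V}) := edges_in (f @: setT).
  apply: (@le_trans _ _ (Ex p (vpairs V)
           (fun G => (#|[set f in B | X f \subset G]| < 1)%N%:R))).
    apply: le_Ex; rewrite ?ltW // => G _; rewrite ltnS leqn0 cards_eq0.
    case: eqP => [|/eqP/set0Pn[f]]; first by case: exists_inP.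
    rewrite in_set in_setI => /andP[/andP[fE fS] fG].
    rewrite (_ : [exists Q in _, _]) //; apply/exists_inP; exists (f @: setT).
      exact: imset_f.
    rewrite [edges_in _ \subset G]fG andbT; apply/fintype.subsetP => _ /imsetP[i _ ->].
    by move: fS; rewrite in_set => /andP[/ffun_onP].
  apply: le_trans (Ex_lower_tail (ltW p0) (ltW p1) (r := 2 ^ k) _ _ _ _) _.
  - by move=> f _; apply/fintype.subsetP => e; rewrite inE => /andP[].
  - by move=> f g; rewrite !in_setI => /andP[fE _] /andP[gE _]; exact: (sparse_disjoint k2 E_inj E2).
  - move=> f; rewrite in_setI => /andP[fE _]; apply: leq_trans (card_edges_in _) _.
    by rewrite card_imset ?cardsT ?card_ord //; apply: E_inj.
  rewrite expr1 ler_wpM2l // -/del.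
  apply: (@le_trans _ _ ((1 - del) ^+ (C * a))).
    by apply: ler_wiXn2l; [lra | lra | exact: (EC S SA aS)].
  rewrite exprM lerXn2r ?nnegrE ?exprn_ge0 ?invr_ge0 //; lra.
rewrite sumr_const card_powerset -/a -[X in X <= _]mulr_natl natrX mulrCA -exprMn.
rewrite (_ : 2 / 4 = 2^-1 :> R); last by lra.
have : (2^-1 : R) ^+ a <= 2^-1 ^+ a1 by apply: ler_wiXn2l => //; rewrite invf_le1 ?ler1n.
by lra.
Qed.

(** * The template graph *)

Lemma contains_KS (s : nat) (T : finType) (E F : {set {set T}}) :
  E \subset F -> contains_K s E -> contains_K s F.
Proof.
move=> EF /existsP[K /andP[Ks /forall_inP KE]]; apply/existsP; exists K.
rewrite Ks; apply/forall_inP => x xK; apply/forall_inP => y yK; apply/implyP => xy.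
by apply: (fintype.subsetP EF); move/forall_inP: (KE x xK) => /(_ y yK)/implyP; apply.
Qed.

(** Take a maximal K_s-free graph between H0 and G. Its last property is what limits the number of
    edges added to H0. *)
Lemma saturated_extension (s : nat) (T : finType) (G H0 : {set {set T}}) :
  H0 \subset G -> ~~ contains_K s H0 ->
  exists H, [/\ K_saturated s G H, H0 \subset H &
    {in H :\: H0, forall e, ~~ contains_K s (e |: H0)}].
Proof.
move=> H0G H0K; pose P (H : {set {set T}}) := (H \subset G) && ~~ contains_K s H.
have [|H /maxsetP[/andP[HG HK] Hmax] H0H] := @maxset_exists _ P H0; first by rewrite /P H0G.
exists H; split=> //.
  rewrite /K_saturated HG HK; apply/forall_inP => e; rewrite in_setD => /andP[eH eG].
  apply: contraNT eH => eK; rewrite -(Hmax (e |: H)) ?setU11 ?subsetUr //.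
  by rewrite /P subUset sub1set eG HG.
move=> e; rewrite in_setD => /andP[_ eH]; apply: contra HK; apply: contains_KS.
by rewrite subUset sub1set eH.
Qed.

Lemma card_dep_pairs (V : finType) (P : pred V) (F : V -> {set V}) :
  #|[set q : V * V | P q.1 && (q.2 \in F q.1)]| = (\sum_(u | P u) #|F u|)%N.
Proof.
under [RHS]eq_bigr => u _ do rewrite -sum1_card.
by rewrite pair_big_dep /= -sum1_card; apply: eq_bigl => q; rewrite inE.
Qed.

Section Template.
Variables (V : finType) (k : nat) (G : {set {set V}}).
(* lab x = 0, 1, 2, 3, 4 says that x lies in A1, A2, A3, B1, W respectively,
   and L 0, L 1, L 2 are the block systems of A1, A2, A3. *)
Variables (lab c : V -> nat) (L : nat -> {set {set V}}).
Hypothesis GV : G \subset vpairs V.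
Hypothesis lab5 : forall x, (lab x < 5)%N.
Hypothesis Lk : forall i Q, (i < 3)%N -> Q \in L i ->
  #|Q| = k /\ {in Q, forall x, lab x = i}.
Hypothesis L1c : forall Q, Q \in L 1 -> {in Q &, injective c}.
Hypothesis Lcl : forall i, (i < 3)%N -> clique_bound k (L i).

Let block x y := [|| joined (L 0) x y, joined (L 1) x y | joined (L 2) x y].

(** Decoded: A1-B1, A1-W, A2-W and A3-B1. The pairs A2-B1 are left to be saturated through A3, and
    [tie] supplies the A2-A3 edges for that. *)
Let cross x y := (lab x, lab y) \in [:: (0, 3); (0, 4); (1, 4); (2, 3)]%N.

Let tie x y := ((lab x, lab y) == (1, 2)%N) && (c x == c y).

Definition template x y := [|| block x y, cross x y, cross y x, tie x y | tie y x].

Definition template_graph : {set {set V}} :=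
  [set e in G | [exists x, [exists y, (e == [set x; y]) && template x y]]].

Let joinedC (M : {set {set V}}) x y : joined M x y = joined M y x.
Proof. by apply: eq_existsb => Q; rewrite [(x \in _) && _]andbC. Qed.

Lemma templateC x y : template x y = template y x.
Proof.
have -> : template x y = [|| block y x, cross x y, cross y x, tie x y | tie y x].
  by rewrite /template /block !(joinedC _ x y).
by rewrite [_ || [|| cross y x, _ | _]]orbCA [tie x y || _]orbC.
Qed.

Lemma vpairs_neq x y : [set x; y] \in G -> x != y.
Proof. by move=> /(fintype.subsetP GV); rewrite inE cards2; case: (eqVneq x y). Qed.

Lemma template_graphE x y :
  ([set x; y] \in template_graph) = ([set x; y] \in G) && template x y.
Proof.
rewrite inE; case: (boolP (_ \in G)) => //= xyG; have xy := vpairs_neq xyG.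
apply/existsP/idP => [[x' /existsP[y' /andP[/eqP e t]]]|t]; last first.
  by exists x; apply/existsP; exists y; rewrite eqxx.
have := set21 x y; have := set22 x y; rewrite {1 2}e !in_set2.
move=> /orP[] /eqP yE /orP[] /eqP xE; rewrite ?xE ?yE ?eqxx in xy *; subst; rewrite ?eqxx // in xy.
  by rewrite templateC.
Qed.

Let joined_lab i x y : (i < 3)%N -> joined (L i) x y -> lab x = i /\ lab y = i.
Proof. by move=> i3 /exists_inP[Q /(Lk i3)[_ Ql] /andP[/Ql-> /Ql->]]. Qed.

Let block_lab x y : block x y -> lab x = lab y /\ (lab x < 3)%N.
Proof. by move=> /or3P[] /joined_lab [] // -> ->. Qed.

Let block_joined x y : block x y -> joined (L (lab x)) x y.
Proof. by move=> /or3P[] j; have [] := joined_lab _ j; rewrite // => ->. Qed.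

(** A clique has at most k vertices in each of A1, A2, A3 and at most one in B. As A1 sees neither
    A2 nor A3, size k + 2 forces vertices in both A2 and A3. Then B contributes none, since A2 sees
    only W and A3 only B1. All its vertices in A2 share the colour of a vertex in A3, but adjacent
    vertices of A2 lie in a rainbow block, so A2 contributes one: at most k + 1 in total. *)
Lemma template_no_K : ~~ contains_K k.+2 template_graph.
Proof.
apply/negP => /existsP[K /andP[/eqP Kk /forall_inP Kc]].
have Kt x y : x \in K -> y \in K -> x != y -> template x y.
  move=> xK yK xy; move/forall_inP: (Kc x xK) => /(_ y yK); rewrite xy /=.
  by rewrite template_graphE => /andP[].
pose Ki i := [set x in K | lab x == i].
pose KB := [set x in K | (2 < lab x)%N].
have KE : (#|K| <= #|Ki 0%N| + #|Ki 1%N| + #|Ki 2%N| + #|KB|)%N.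
  apply: (@leq_trans #|Ki 0%N :|: Ki 1%N :|: Ki 2%N :|: KB|).
    apply/subset_leq_card/fintype.subsetP => x xK; rewrite !inE xK /=.
    by case: (lab x) => [|[|[|]]].
  do 2!(apply: leq_trans (leq_card_setU _ _) _; rewrite leq_add2r).
  exact: leq_card_setU.
have same_block x y : x \in K -> y \in K -> x != y -> lab x = lab y -> block x y.
  move=> xK yK xy lxy; have := Kt _ _ xK yK xy.
  rewrite /template /cross /tie lxy; have := lab5 y.
  by case: (lab y) => [|[|[|[|[|]]]]] //= _; rewrite ?orbF.
have Kik i : (i < 3)%N -> (#|Ki i| <= k)%N.
  move=> i3; apply: (Lcl i3) => x y; rewrite !inE => /andP[xK /eqP xi] /andP[yK /eqP yi] xy.
  by rewrite -xi; apply/block_joined/same_block; rewrite ?xi.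
have KB1 : (#|KB| <= 1)%N.
  rewrite leqNgt; apply/negP => /card_gt1P[x [y []]]; rewrite !inE.
  move=> /andP[xK xl] /andP[yK yl] xy; have /or4P[b|||] := Kt _ _ xK yK xy.
  - by have [_] := block_lab b; rewrite ltnNge xl.
  - by move: xl yl; rewrite /cross; case: (lab x) => [|[|[|]]]; case: (lab y) => [|[|[|]]].
  - by move: xl yl; rewrite /cross; case: (lab x) => [|[|[|]]]; case: (lab y) => [|[|[|]]].
  - by move: xl yl; rewrite /tie; case: (lab x) => [|[|[|]]]; case: (lab y) => [|[|[|]]].
have diff x y : lab x != lab y -> x != y by apply: contra => /eqP ->.
have sep x y : x \in K -> y \in K -> lab x != lab y ->
    [|| cross x y, cross y x, tie x y | tie y x].
  move=> xK yK lxy; have /orP[/block_lab[lE _]|//] := Kt _ _ xK yK (diff _ _ lxy).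
  by rewrite lE eqxx in lxy.
have Ki0 i : #|Ki i| = 0%N \/ exists2 x, x \in K & lab x = i.
  have [->|/set0Pn[x]] := eqVneq (Ki i) set0; first by left; rewrite cards0.
  by rewrite inE => /andP[xK /eqP xi]; right; exists x.
have K0 := Kik 0%N isT; have K1 := Kik 1%N isT; have K2 := Kik 2%N isT.
case: (Ki0 0%N) => [e0|[x0 x0K x0l]]; last first.
  case: (Ki0 1%N) => [e1|[y yK yl]]; last first.
    by have := sep _ _ x0K yK; rewrite /cross /tie x0l yl => /(_ isT).
  case: (Ki0 2%N) => [e2|[y yK yl]]; last first.
    by have := sep _ _ x0K yK; rewrite /cross /tie x0l yl => /(_ isT).
  by move: KE K0 KB1; rewrite e1 e2 Kk; clear; lia.
case: (Ki0 1%N) => [e1|[x1 x1K x1l]].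
  by move: KE K2 KB1; rewrite e0 e1 Kk; clear; lia.
case: (Ki0 2%N) => [e2|[x2 x2K x2l]].
  by move: KE K1 KB1; rewrite e0 e2 Kk; clear; lia.
have KB0 : #|KB| = 0%N.
  apply/eqP; rewrite cards_eq0; apply/eqP/setP => y; rewrite !inE.
  apply/negbTE/negP => /andP[yK yl].
  have := sep _ _ x1K yK; have := sep _ _ x2K yK; have := lab5 y.
  rewrite /cross /tie x1l x2l; move: yl.
  by case: (lab y) => [|[|[|[|[|]]]]] //= _ _ => [_ /(_ isT)|/(_ isT)].
suff K11 : (#|Ki 1%N| <= 1)%N by move: KE K2 K11; rewrite e0 KB0 Kk; clear; lia.
rewrite leqNgt; apply/negP => /card_gt1P[x [y []]]; rewrite !inE.
move=> /andP[xK /eqP xl] /andP[yK /eqP yl] xy.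
have cx2 z : z \in K -> lab z = 1%N -> c z = c x2.
  move=> zK zl; have := sep _ _ zK x2K; rewrite /cross /tie zl x2l /= => /(_ isT).
  by rewrite orbF => /eqP.
have := block_joined (same_block _ _ xK yK xy (etrans xl (esym yl))).
rewrite xl => /exists_inP[Q QL /andP[xQ yQ]]; move/eqP: xy; apply.
by apply: (L1c QL) => //; rewrite !cx2.
Qed.

Definition nbr x := [set y | [set x; y] \in G].

(** A complete block of k common neighbours, together with u and v, becomes a K_(k+2) once uv is
    added. *)
Lemma saturating_block i Q u v : (i < 3)%N -> Q \in L i -> edges_in Q \subset G ->
  u != v -> lab u != i -> lab v != i ->
  {in Q, forall x, template u x} -> {in Q, forall x, template v x} ->
  Q \subset nbr u -> Q \subset nbr v ->
  contains_K k.+2 ([set u; v] |: template_graph).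
Proof.
move=> i3 QL QG uv ui vi uQ vQ Qu Qv; have [Qk Ql] := Lk i3 QL.
have nQ w : lab w != i -> w \notin Q by apply: contra => /Ql ->.
apply/existsP; exists (u |: (v |: Q)).
rewrite !cardsU1 in_setU1 negb_or uv !nQ // Qk eqxx /=.
have inT w x : lab w != i -> {in Q, forall x, template w x} -> Q \subset nbr w ->
    x \in Q -> [set w; x] \in template_graph.
  move=> wi wQ Qw xQ; rewrite template_graphE wQ // andbT.
  by move/fintype.subsetP: Qw => /(_ x xQ); rewrite inE.
apply/forall_inP => x; rewrite !in_setU1 => xK; apply/forall_inP => y.
rewrite !in_setU1 => yK; apply/implyP => xy.
case/or3P: xK xy => [/eqP ->|/eqP ->|xQ]; case/or3P: yK => [/eqP ->|/eqP ->|yQ]; rewrite ?eqxx // => xy.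
- by rewrite inT ?orbT.
- by rewrite setUC eqxx.
- by rewrite inT ?orbT.
- by rewrite [[set x; u]]setUC inT ?orbT.
- by rewrite [[set x; v]]setUC inT ?orbT.
apply/orP; right; rewrite template_graphE; apply/andP; split.
  apply: (fintype.subsetP QG); rewrite !inE cards2 xy /= subUset !sub1set.
  by rewrite xQ.
have : joined (L i) x y by apply/exists_inP; exists Q; rewrite // xQ.
by rewrite /template /block; move: i3; case: (i) => [|[|[|]]] // _ ->; rewrite ?orbT.
Qed.

Variables (R : realType) (gam : R).

Definition cls i := [set x | lab x == i].

Definition few_common i u v :=
  #|nbr u :&: nbr v :&: cls i|%:R < gam * #|cls i|%:R.

Definition no_slot x u := ~~ [exists Q in L 2, [&& edges_in Q \subset G,
  Q \subset nbr x, Q \subset nbr u & [forall y in Q, c y == c x]]].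

(** The three [bad] sets cover the edges outside the template that H may gain, apart from those
    inside A1, A2 and A3 or meeting A3. The second end ranges over all of B because membership in B,
    unlike membership in B1, does not depend on G. *)
Definition bad_A2B := [set q : V * V | [&& lab q.1 == 1%N, (2 < lab q.2)%N &
  no_slot q.1 q.2]].

Definition bad_B1B := [set q : V * V | [&& lab q.1 == 3%N, (2 < lab q.2)%N,
  q.1 != q.2 & few_common 0 q.1 q.2]].

Definition bad_BB := [set q : V * V | [&& (2 < lab q.1)%N, (2 < lab q.2)%N,
  q.1 != q.2 & few_common 1 q.1 q.2]].

Hypothesis dense : forall i (S : {set V}), (i < 2)%N -> S \subset cls i ->
  gam * #|cls i|%:R <= #|S|%:R ->
  exists2 Q : {set V}, Q \in L i & (Q \subset S) && (edges_in Q \subset G).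

Let crossT i u x : (i, lab u) \in [:: (0, 3); (0, 4); (1, 4); (2, 3)]%N ->
  lab x = i -> template u x.
Proof. by rewrite /template /cross => ui ->; rewrite ui !orbT. Qed.

Lemma common_saturates i u v : (i < 2)%N -> u != v ->
  (i, lab u) \in [:: (0, 3); (0, 4); (1, 4); (2, 3)]%N ->
  (i, lab v) \in [:: (0, 3); (0, 4); (1, 4); (2, 3)]%N ->
  ~~ few_common i u v -> contains_K k.+2 ([set u; v] |: template_graph).
Proof.
move=> i2 uv ui vi; rewrite -leNgt => big.
have [Q QL /andP[]] := dense i2 (subsetIr _ _) big.
rewrite !subsetI => /andP[/andP[Qu Qv] Qi] QG.
have i3 : (i < 3)%N by apply: ltnW.
have ne w : (i, lab w) \in [:: (0, 3); (0, 4); (1, 4); (2, 3)]%N -> lab w != i.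
  by move: i2; case: (i) => [|[|]] // _; apply: contraTneq => ->.
have lQ x : x \in Q -> lab x = i by move=> /(fintype.subsetP Qi); rewrite inE => /eqP.
by apply: (saturating_block i3 QL) => //; rewrite ?ne // => x /lQ; apply: crossT.
Qed.

Lemma slot_saturates x u : lab x = 1%N -> lab u = 3%N -> ~~ no_slot x u ->
  contains_K k.+2 ([set x; u] |: template_graph).
Proof.
move=> xl ul; rewrite negbK => /exists_inP[Q QL /and4P[QG Qx Qu /forall_inP Qc]].
have xu : x != u by apply: contra_eq_neq xl => ->; rewrite ul.
have [_ Ql] := Lk (isT : (2 < 3)%N) QL.
apply: (saturating_block _ QL) => //; rewrite ?xl ?ul // => y yQ.
  by rewrite /template /tie xl (Ql y yQ) eq_sym (Qc y yQ) eqxx !orbT.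
by apply: (@crossT 2); rewrite ?ul ?Ql.
Qed.

(** The main term counts the A1-B1 edges, all of which belong to the template. Any other edge of H
    meets W and A1 or A2, meets A3, lies inside the union of the A's, or belongs to a bad set. Edges
    are counted through ordered pairs, as double counting is harmless in an upper bound. *)
Lemma template_saturated : exists H, [/\ K_saturated k.+2 G H,
  (\sum_(u in cls 3) #|nbr u :&: cls 0| <= #|H|)%N &
  (#|H| <= \sum_(u in cls 3) #|nbr u :&: cls 0| +
     #|cls 4| * (#|cls 0| + #|cls 1|) + #|cls 2| * #|V| +
     (#|cls 0| + #|cls 1| + #|cls 2|) ^ 2 +
     #|bad_A2B| + #|bad_B1B| + #|bad_BB|)%N].
Proof.
have H0G : template_graph \subset G by apply/fintype.subsetP => e; rewrite inE => /andP[].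
have [H [Hs H0H Hbad]] := saturated_extension H0G template_no_K.
have HG : H \subset G by case/and3P: Hs.
pose P0 := [set q : V * V | (q.1 \in cls 3) && (q.2 \in nbr q.1 :&: cls 0)].
have P0E : #|P0| = (\sum_(u in cls 3) #|nbr u :&: cls 0|)%N.
  exact: (card_dep_pairs (mem (cls 3))).
pose f (q : V * V) := [set q.1; q.2].
exists H; split=> //; rewrite -P0E.
  rewrite -(@card_in_imset _ _ f); last first.
    move=> [u x] [u' x']; rewrite !inE /= => /and3P[/eqP u3 _ /eqP x0] /and3P[/eqP u3' _ /eqP x0'].
    rewrite /f /= => e; have := set21 u x; have := set22 u x; rewrite e !in_set2.
    move=> /orP[/eqP xu|/eqP ->]; first by rewrite xu u3' in x0.
    by move=> /orP[/eqP -> //|/eqP ux]; rewrite ux x0' in u3.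
  apply/subset_leq_card/fintype.subsetP => _ /imsetP[[u x] ux ->].
  move: ux; rewrite !inE /= => /and3P[/eqP u3 ux /eqP x0].
  apply: (fintype.subsetP H0H); rewrite template_graphE ux /=.
  by apply: (@crossT 0); rewrite ?u3.
pose P1 := setX (cls 4) (cls 0 :|: cls 1).
pose P2 := setX (cls 2) [set: V].
pose A := cls 0 :|: cls 1 :|: cls 2.
pose P3 := setX A A.
pose P := P0 :|: P1 :|: P2 :|: P3 :|: bad_A2B :|: bad_B1B :|: bad_BB.
have cP : (#|P| <= #|P0| + #|cls 4| * (#|cls 0| + #|cls 1|) + #|cls 2| * #|V| +
     (#|cls 0| + #|cls 1| + #|cls 2|) ^ 2 +
     #|bad_A2B| + #|bad_B1B| + #|bad_BB|)%N.
  do 3!(apply: leq_trans (leq_card_setU _ _) _; rewrite leq_add2r).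
  apply: leq_trans (leq_card_setU _ _) (leq_add _ _); last first.
    rewrite cardsX -mulnn leq_mul //; apply: leq_trans (leq_card_setU _ _) _;
      by rewrite leq_add2r leq_card_setU.
  apply: leq_trans (leq_card_setU _ _) (leq_add _ _); last by rewrite cardsX cardsT.
  apply: leq_trans (leq_card_setU _ _) (leq_add _ _) => //.
  by rewrite cardsX leq_mul2l leq_card_setU orbT.
apply: leq_trans cP; apply: leq_trans (leq_imset_card f P).
apply/subset_leq_card/fintype.subsetP => e eH.
have eG := fintype.subsetP HG _ eH.
have /cards2P[x [y [xy eE]]] : #|e| == 2%N.
  by move/(fintype.subsetP GV): eG; rewrite inE.
move: eH eG; rewrite eE => {e eE}.
wlog lxy : x y xy / (lab x <= lab y)%N.
  have [lxy|/ltnW lyx] := leqP (lab x) (lab y); first by apply.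
  by rewrite setUC => h; apply: h lyx; rewrite eq_sym.
move=> eH eG.
(* An edge that H gained beyond the template completes no K_(k+2) with it; saturated pairs are
   excluded in this way. *)
have unsat : ~~ template x y -> ~~ contains_K k.+2 ([set x; y] |: template_graph).
  by move=> t; apply: Hbad; rewrite in_setD eH template_graphE negb_and t orbT.
have toP q : f q = [set x; y] -> q \in P -> [set x; y] \in f @: P.
  by move=> <- qP; apply: imset_f.
have nblock : lab x != lab y \/ (2 < lab x)%N -> block x y = false.
  by move=> h; apply/negP => /block_lab[xe x3]; case: h; rewrite ?xe ?eqxx // ltnNge -xe -ltnS x3.
have fC : f (y, x) = [set x; y] by rewrite /f setUC.
have nt (i j : nat) : lab x = i -> lab y = j -> template x y =
   [|| block x y, (i, j) \in [:: (0, 3); (0, 4); (1, 4); (2, 3)],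
     (j, i) \in [:: (0, 3); (0, 4); (1, 4); (2, 3)],
     ((i, j) == (1, 2)) && (c x == c y) | ((j, i) == (1, 2)) && (c y == c x)]%N.
  by move=> <- <-.
have inA z : (lab z < 3)%N -> z \in A.
  by rewrite !inE; case: (lab z) => [|[|[|]]].
have [y3|y3] := ltnP (lab y) 3.
  apply: (toP (x, y)) => //; suff : (x, y) \in P3 by rewrite !in_setU => ->; rewrite ?orbT.
  by rewrite inE /= !inA // (leq_ltn_trans lxy).
have [/eqP xl|x2] := boolP (lab x == 2%N).
  apply: (toP (x, y)) => //; suff : (x, y) \in P2 by rewrite !in_setU => ->; rewrite ?orbT.
  by rewrite !inE /= xl.
have inB1B : lab x = 3%N -> [set x; y] \in f @: P.
  move=> xl; apply: (toP (x, y)) => //.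
  suff : (x, y) \in bad_B1B by rewrite !in_setU => ->; rewrite ?orbT.
  rewrite inE /= xl y3 xy /=; apply: contraTT (unsat _) => [fc|].
    apply/negPn; apply: common_saturates fc => //; first by rewrite xl.
    by move: y3 (lab5 y); case: (lab y) => [|[|[|[|[|]]]]].
  rewrite /template nblock ?xl; last by right.
  by rewrite /cross /tie xl; move: y3 (lab5 y); case: (lab y) => [|[|[|[|[|]]]]].
have := lab5 y; move: y3 lxy.
case yl : (lab y) => [|[|[|[|[|//]]]]] // _ lxy _.
  move: lxy x2; case xl : (lab x) => [|[|[|[|//]]]] // _ _; last exact: inB1B.
    apply: (toP (y, x)) => //; suff : (y, x) \in P0 by rewrite !in_setU => ->; rewrite ?orbT.
    by rewrite !inE /= yl xl setUC eG.
  apply: (toP (x, y)) => //.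
  suff : (x, y) \in bad_A2B by rewrite !in_setU => ->; rewrite ?orbT.
  rewrite inE /= xl yl /=; apply: contraTT (unsat _) => [ns|].
    by apply/negPn; apply: slot_saturates.
  by rewrite (nt _ _ xl yl) nblock // xl yl; left.
move: lxy x2; case xl : (lab x) => [|[|[|[|[|//]]]]] // _ _.
- apply: (toP (y, x)) => //; suff : (y, x) \in P1 by rewrite !in_setU => ->; rewrite ?orbT.
  by rewrite !inE /= yl xl.
- apply: (toP (y, x)) => //; suff : (y, x) \in P1 by rewrite !in_setU => ->; rewrite ?orbT.
  by rewrite !inE /= yl xl.
- exact: inB1B.
apply: (toP (x, y)) => //; suff : (x, y) \in bad_BB by rewrite !in_setU => ->; rewrite ?orbT.
rewrite inE /= xl yl xy /=; apply: contraTT (unsat _) => [fc|].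
  by apply/negPn; apply: common_saturates fc => //; rewrite ?xl ?yl.
by rewrite (nt _ _ xl yl) nblock // xl yl; right.
Qed.


End Template.

(** * Probability estimates in G(n,p) *)

Section Estimates.
Variables (R : realType) (p : R) (V : finType).
Hypotheses (p0 : 0 < p) (p1 : p < 1).
Implicit Types (u v x : V) (A : {set V}) (G : {set {set V}}).

Let E := Ex p (vpairs V).

Let p0' : 0 <= p. Proof. exact: ltW. Qed.
Let p1' : p <= 1. Proof. exact: ltW. Qed.

Lemma pair_vpairs u x : u != x -> [set u; x] \in vpairs V.
Proof. by move=> ux; rewrite inE cards2 ux. Qed.

Lemma pair_inj u x y : [set u; x] = [set u; y] -> x = y.
Proof.
move=> e; have := set22 u x; have := set22 u y; rewrite -{1}e {2}e !in_set2.
by move=> /orP[] /eqP yx /orP[] /eqP xy; rewrite // xy yx.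
Qed.

Lemma pair_cross u v x y : u != v -> u != y -> [set u; x] != [set v; y].
Proof.
move=> uv uy; apply/eqP => e; have := set21 u x.
by rewrite e in_set2 (negbTE uv) (negbTE uy).
Qed.

(** The edges from u to A are independent, so the covariances vanish and each of the |A| variances
    is at most 1. *)
Lemma degree_variance u A : u \notin A ->
  E (fun G => (#|nbr G u :&: A|%:R - p * #|A|%:R) ^+ 2) <= #|A|%:R.
Proof.
move=> uA.
have ux x : x \in A -> u != x by move=> xA; apply: contraNneq uA => ->.
pose I x G : R := ([set u; x] \in G)%:R.
have EI x : x \in A -> E (I x) = p by move=> xA; rewrite /E Ex_mem ?pair_vpairs ?ux.
rewrite [leLHS](_ : _ = E (fun G => \sum_(x in A) \sum_(y in A) (I x G - p) * (I y G - p))).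
  rewrite /E Ex_sum -sumr_const; apply: ler_sum => x xA; rewrite Ex_sum.
  rewrite (bigD1 x) //= [X in _ + X]big1 ?addr0.
    rewrite -[leRHS](Ex_cst p (vpairs V)); apply: le_Ex => // G _.
    rewrite /I; case: (_ \in G) => /=; rewrite ?sub0r ?mulrNN.
      by apply: mulr_ile1; rewrite ?subr_ge0 // lerBlDr lerDl.
    exact: mulr_ile1.
  move=> y /andP[yA yx].
  have Exy : E (fun G => I x G * I y G) = p ^+ 2.
    have -> : p ^+ 2 = p ^+ #|[set [set u; x]; [set u; y]]|.
      by rewrite cards2 (contra_neq (@pair_inj u x y)) // eq_sym.
    rewrite /E -(@Ex_subset _ _ p (vpairs V)); last first.
      by rewrite subUset !sub1set !pair_vpairs ?ux.
    by apply: eq_Ex => G _; rewrite subUset !sub1set /I -natrM mulnb.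
  rewrite (@eq_Ex _ _ _ _ _ (fun G => I x G * I y G + ((- p) * I x G + ((- p) * I y G + p ^+ 2)))).
    by rewrite !ExD !ExZ Ex_cst -!/E Exy !EI //; ring.
  by move=> G _; ring.
apply: eq_Ex => G _.
have -> : #|nbr G u :&: A|%:R - p * #|A|%:R = \sum_(x in A) (I x G - p).
  rewrite sumrB sumr_const mulr_natr; congr (_ - _).
  rewrite -sum1_card natr_sum big_mkcond [RHS]big_mkcond /=.
  apply: eq_bigr => x _; rewrite /I !inE andbC.
  by case: (x \in A); case: (_ \in G).
by rewrite expr2 big_distrlr.
Qed.

Lemma degree_deviation u A (t : R) : u \notin A -> 0 < t ->
  E (fun G => (t ^+ 2 < (#|nbr G u :&: A|%:R - p * #|A|%:R) ^+ 2)%R%:R)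
    <= #|A|%:R / t ^+ 2.
Proof.
move=> uA t0; have t2 : 0 < t ^+ 2 by rewrite exprn_gt0.
apply: (le_trans (Ex_markov p0' p1' t2 _)) => [G _|]; first exact: sqr_ge0.
by rewrite ler_wpM2r ?invr_ge0 ?(ltW t2) // degree_variance.
Qed.

Section Codegree.
Variables (u v : V) (A : {set V}).
Hypotheses (uv : u != v) (uA : u \notin A) (vA : v \notin A).

Let X x := [set [set u; x]; [set v; x]].

Let uX x : x \in A -> u != x. Proof. by move=> xA; apply: contraNneq uA => ->. Qed.
Let vX x : x \in A -> v != x. Proof. by move=> xA; apply: contraNneq vA => ->. Qed.

Let XV : {in A, forall x, X x \subset vpairs V}.
Proof. by move=> x xA; rewrite subUset !sub1set !pair_vpairs ?uX ?vX. Qed.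

Let Xd : {in A &, forall x y, x != y -> [disjoint X x & X y]}.
Proof.
move=> x y xA yA xy; rewrite -setI_eq0; apply/eqP/setP => e; rewrite in_setI in_set0.
apply/negbTE/negP; rewrite !in_set2 => /andP[/orP[] /eqP -> /orP[] /eqP e'].
- by move: xy; rewrite (pair_inj e') eqxx.
- by move: (@pair_cross u v x y uv (uX yA)); rewrite e' eqxx.
- by move: (@pair_cross v u x y); rewrite e' eqxx eq_sym uv vX // => /(_ isT isT).
- by move: xy; rewrite (pair_inj e') eqxx.
Qed.

(* The weight E[mu^-deg * t^codeg] is 1 for mu = E[t^Bernoulli(p)]. *)
Lemma high_degree_low_codegree (t : R) (d N : nat) : 0 < t -> t < 1 ->
  E (fun G => ((d <= #|nbr G u :&: A|) && (#|nbr G u :&: nbr G v :&: A| <= N))%N%:R)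
   <= t^-1 ^+ N * (1 - p + p * t) ^+ d.
Proof.
move=> t0 t1; set mu := 1 - p + p * t.
have mu0 : 0 < mu by rewrite ltr_pwDl ?subr_gt0 // mulr_ge0 // ltW.
have mu1 : mu <= 1.
  by rewrite /mu -addrA gerDl addrC subr_le0 ler_piMr // ltW.
pose F x G : R := if [set u; x] \in G then mu^-1 * (if [set v; x] \in G then t else 1) else 1.
have F0 x G : 0 < F x G.
  by rewrite /F; case: ifP => // _; case: ifP => _; rewrite mulr_gt0 ?invr_gt0.
have EF : E (fun G => \prod_(x in A) F x G) = 1.
  rewrite /E (Ex_prod_in _ XV Xd); last first.
    by move=> x xA G; rewrite /F /X !in_setI !in_set2 !eqxx orbT !andbT.
  rewrite big1 // => x xA; rewrite /X Ex_setU1; last first.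
    by rewrite in_set1; apply: pair_cross uv (uX xA).
  have ne : ([set v; x] == [set u; x]) = false.
    by apply/negbTE/pair_cross; [rewrite eq_sym | exact: vX].
  rewrite !Ex_set1 /F !in_setU1 !in_set1 !in_set0 !eqxx /= ne orbF.
  rewrite [[set u; x] == _]eq_sym ne /= ?orbT.
  by rewrite /mu in mu0 *; field; rewrite gt_eqF.
(* On the event the weight is at least [mu^-1 ^+ d * t ^+ N], since mu <= 1 and t < 1; this is
   Markov's inequality for the weight. *)
apply: (@le_trans _ _ (E (fun G => t^-1 ^+ N * mu ^+ d * \prod_(x in A) F x G))); last first.
  by rewrite /E ExZ -/E EF mulr1.
apply: le_Ex => // G _.
have c0 : 0 <= t^-1 ^+ N * mu ^+ d.
  by rewrite mulr_ge0 // exprn_ge0 ?invr_ge0 // ltW.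
case: (boolP (_ && _)) => [/andP[dd NN]|_]; last first.
  by rewrite mulr_ge0 // prodr_ge0 // => x _; exact: ltW.
have -> : \prod_(x in A) F x G =
    mu^-1 ^+ #|nbr G u :&: A| * t ^+ #|nbr G u :&: nbr G v :&: A|.
  rewrite -!prodr_const [X in _ = X * _]big_mkcond [X in _ = _ * X]big_mkcond.
  rewrite [LHS]big_mkcond -big_split; apply: eq_bigr => x _ /=.
  rewrite !inE /F; case: (x \in A); rewrite ?andbF ?andbT ?mulr1 //.
  by case: ([set u; x] \in G); case: ([set v; x] \in G); rewrite ?mulr1 ?mul1r.
rewrite [X in _ * X]mulrC mulrACA.
have h1 : 1 <= t^-1 ^+ N * t ^+ #|nbr G u :&: nbr G v :&: A|.
  rewrite -(subnK NN) exprD -mulrA -exprMn mulVf ?gt_eqF // expr1n mulr1.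
  by rewrite exprn_ege1 // invf_ge1 // ltW.
have h2 : 1 <= mu ^+ d * mu^-1 ^+ #|nbr G u :&: A|.
  rewrite -(subnKC dd) exprD mulrA -exprMn divff ?gt_eqF // expr1n mul1r.
  by rewrite exprn_ege1 // invf_ge1.
by rewrite -[leLHS]mulr1; apply: ler_pM.
Qed.

(** The pairs of edges from u and v to a vertex of A are disjoint for different vertices, so the
    lower tail bound applies with r = 2. *)
Lemma low_codegree (N : nat) :
  E (fun G => (#|nbr G u :&: nbr G v :&: A| < N)%N%:R)
   <= 2 ^+ N * (1 - p ^+ 2 / 2) ^+ #|A|.
Proof.
rewrite /E (@eq_Ex _ _ _ _ _ (fun G => (#|[set x in A | X x \subset G]| < N)%N%:R)).
  by apply: Ex_lower_tail => // x xA; rewrite cards2; case: (_ != _).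
move=> G _; rewrite (_ : [set x in A | _] = nbr G u :&: nbr G v :&: A) //.
by apply/setP => x; rewrite !inE subUset !sub1set andbC.
Qed.

End Codegree.

(** At least y disjoint slots have the colour of x, and each works independently with probability
    bounded below. *)
Lemma no_slot_prob (L : nat -> {set {set V}}) (c : V -> nat) (k y : nat) x u :
  x != u -> {in L 2, forall Q : {set V}, [/\ x \notin Q, u \notin Q & #|Q| = k]} ->
  {in L 2 &, forall Q Q' : {set V}, Q != Q' -> [disjoint Q & Q']} ->
  (y <= #|[set Q in L 2 | [forall z in Q, c z == c x]]|)%N ->
  E (fun G => (no_slot G c L x u)%:R) <= 2 * (1 - p ^+ (2 ^ k.+2) / 2) ^+ y.
Proof.
move=> xu LQ Ld Ly; set B := [set Q in L 2 | _] in Ly.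
(* The pair xu lies in each of these edge sets and is removed to make them disjoint. *)
pose X Q := edges_in (x |: (u |: Q)) :\ [set x; u].
have pk : 0 < p ^+ (2 ^ k.+2) <= 1 by rewrite exprn_gt0 // exprn_ile1.
apply: (@le_trans _ _ (E (fun G => (#|[set Q in B | X Q \subset G]| < 1)%N%:R))).
  apply: le_Ex => // G _; rewrite ltnS leqn0 cards_eq0.
  case: eqP => [|/eqP/set0Pn[Q]]; first by case: no_slot.
  rewrite !in_set => /andP[/andP[QL Qc] XG]; have [xQ uQ Qk] := LQ Q QL.
  have XQ e : e \in vpairs V -> e \subset x |: (u |: Q) -> e != [set x; u] -> e \in G.
    move=> eV eQ exu; apply: (fintype.subsetP XG).
    by rewrite in_setD1 exu inE eV.
  rewrite /no_slot (_ : [exists Q in L 2, _]) //; apply/exists_inP; exists Q => //.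
  apply/and4P; split=> //; apply/fintype.subsetP => e.
  - rewrite inE => /andP[eV eQ]; apply: XQ => //.
      by apply: subset_trans eQ _; rewrite setUA subsetUr.
    apply: contraNneq xQ => exu; apply: (fintype.subsetP eQ).
    by rewrite exu set21.
  - move=> eQ; rewrite inE; apply: XQ.
    + by apply: pair_vpairs; apply: contraNneq xQ => ->.
    + by rewrite subUset !sub1set !in_setU1 eqxx eQ !orbT.
    + by apply: contraNneq uQ => /pair_inj <-.
  - move=> eQ; rewrite inE; apply: XQ.
    + by apply: pair_vpairs; apply: contraNneq uQ => ->.
    + by rewrite subUset !sub1set !in_setU1 eqxx eQ !orbT.
    + by rewrite [[set x; u]]setUC; apply: contraNneq xQ => /pair_inj <-.
apply: le_trans (Ex_lower_tail p0' p1' (r := 2 ^ k.+2) _ _ _ _) _.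
- by move=> Q _; apply/fintype.subsetP => e; rewrite !inE => /and3P[].
- move=> Q Q'; rewrite !in_set => /andP[QL _] /andP[QL' _] QQ'.
  rewrite -setI_eq0; apply/eqP/setP => e; rewrite in_setI in_set0.
  apply/negbTE/negP; rewrite !in_setD1 ![e \in edges_in _]inE.
  move=> /andP[/and3P[exu /[!inE] /eqP e2 eQ] /and3P[_ _ eQ']].
  move/eqP: exu; apply; apply/eqP; rewrite eqEcard cards2 xu e2 andbT.
  apply/fintype.subsetP => z ze.
  move/fintype.subsetP: eQ => /(_ z ze); move/fintype.subsetP: eQ' => /(_ z ze).
  rewrite !inE; case: (z == x) => //=; case: (z == u) => //= zQ' zQ.
  by move: (Ld Q Q' QL QL' QQ'); rewrite -setI_eq0 => /eqP/setP/(_ z); rewrite !inE zQ zQ'.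
- move=> Q; rewrite in_set => /andP[QL _]; have [xQ uQ Qk] := LQ Q QL.
  apply: leq_trans (subset_leq_card (subD1set _ _)) _.
  apply: leq_trans (card_edges_in _) _.
  by rewrite !cardsU1 in_setU1 negb_or xu xQ uQ Qk.
rewrite expr1 ler_wpM2l //.
by apply: ler_wiXn2l => //; lra.
Qed.

End Estimates.

(** * Layout of the vertex set and numerical bounds *)

Section Layout.
Variable n : nat.

Definition band (b a : nat) : {set 'I_n} := [set x : 'I_n | (b <= x < b + a)%N].

Lemma card_band b a : (b + a <= n)%N -> #|band b a| = a.
Proof.
move=> ban; have lt (i : 'I_a) : (b + i < n)%N by have := ltn_ord i; lia.
have -> : band b a = [set Ordinal (lt i) | i : 'I_a].
  apply/setP => x; rewrite inE; apply/idP/imsetP => [xb|[i _ ->]] /=; last first.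
    by have := ltn_ord i; lia.
  have xa : (x - b < a)%N by lia.
  by exists (Ordinal xa) => //; apply: val_inj => /=; lia.
rewrite card_imset ?card_ord // => i j /(congr1 val) /= /eqP.
by rewrite eqn_add2l => /eqP /val_inj.
Qed.

(** Within a residue class, x is determined by the quotient of x - b by m. *)
Lemma card_residue b a m t : (0 < m)%N ->
  (#|[set x in band b a | x %% m == t]| <= (a %/ m).+1)%N.
Proof.
move=> m0; pose f (x : 'I_n) : 'I_(a %/ m).+1 := inord ((x - b) %/ m).
rewrite -[leqRHS]card_ord -(@card_in_imset _ _ f) ?max_card // => x y.
rewrite !inE => /andP[/andP[bx xa] /eqP xt] /andP[/andP[by_ ya] /eqP yt].
have le z : (z < b + a -> (z - b) %/ m < (a %/ m).+1)%N.
  by move=> za; rewrite ltnS leq_div2r //; lia.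
move=> /(congr1 val); rewrite /= !inordK ?le // => q.
have r : ((x - b) %% m = (y - b) %% m)%N.
  by apply/eqP; rewrite -(eqn_modDr b) !subnK // xt yt.
have : (x - b = y - b)%N by rewrite (divn_eq (x - b) m) (divn_eq (y - b) m) q r.
by move=> xy; apply: val_inj => /=; lia.
Qed.

Variables (b k : nat).
Hypothesis k0 : (0 < k)%N.

Definition slot (j : nat) : {set 'I_n} := band (b + j * k) k.

Lemma slot_index j x : x \in slot j -> ((x - b) %/ k = j)%N.
Proof.
rewrite inE => /andP[jx xj].
rewrite (_ : (x - b = j * k + (x - b - j * k))%N); last lia.
by rewrite divnMDl // divn_small ?addn0 //; lia.
Qed.

Variables (y m : nat).
Hypotheses (m0 : (0 < m)%N) (bn : (b + y * m * k <= n)%N).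

Definition slots : {set {set 'I_n}} := [set slot j | j : 'I_(y * m)].

Lemma slot_fits j : (j < y * m)%N -> (b + j * k + k <= n)%N.
Proof.
move=> jm; apply: leq_trans bn; rewrite -addnA leq_add2l -mulSnr leq_mul2r jm.
by rewrite orbT.
Qed.

Lemma slots_card Q : Q \in slots -> #|Q| = k.
Proof. by move=> /imsetP[j _ ->]; rewrite card_band // slot_fits. Qed.

Lemma slots_band Q : Q \in slots -> Q \subset band b (y * m * k).
Proof.
move=> /imsetP[j _ ->]; apply/fintype.subsetP => x; rewrite !inE.
move=> /andP[jx xj]; apply/andP; split; first by lia.
apply: leq_trans xj _; rewrite -addnA leq_add2l -mulSnr leq_mul2r.
by rewrite ltn_ord orbT.
Qed.

Lemma slots_eq Q Q' x : Q \in slots -> Q' \in slots -> x \in Q -> x \in Q' -> Q = Q'.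
Proof.
by move=> /imsetP[j _ ->] /imsetP[j' _ ->] /slot_index <- /slot_index <-.
Qed.

Lemma slots_disjoint : {in slots &, forall Q Q' : {set 'I_n}, Q != Q' -> [disjoint Q & Q']}.
Proof.
move=> Q Q' QL QL' QQ'; rewrite -setI_eq0; apply/eqP/setP => x.
rewrite in_setI in_set0; apply/negbTE/negP => /andP[xQ xQ'].
by rewrite (slots_eq QL QL' xQ xQ') eqxx in QQ'.
Qed.

Lemma slots_clique_bound : clique_bound k slots.
Proof.
move=> K Kj; have [->|/set0Pn[x xK]] := eqVneq K set0; first by rewrite cards0.
have [Kx|/subsetPn[z zK]] := boolP (K \subset [set x]).
  by apply: leq_trans (subset_leq_card Kx) _; rewrite cards1.
rewrite in_set1 eq_sym => xz.
have /exists_inP[Q QL /andP[xQ _]] := Kj _ _ xK zK xz.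
rewrite -(slots_card QL); apply/subset_leq_card/fintype.subsetP => w wK.
have [->//|xw] := eqVneq w x; rewrite eq_sym in xw.
have /exists_inP[Q' QL' /andP[xQ' wQ']] := Kj _ _ xK wK xw.
by rewrite (slots_eq QL QL' xQ xQ').
Qed.

(** The slots numbered t, t + m, t + 2m, ... have colour t, and y of them fit. *)
Lemma slots_colour (c : 'I_n -> nat) (t : nat) : (t < m)%N ->
  {in band b (y * m * k), forall x, c x = ((x - b) %/ k %% m)%N} ->
  (y <= #|[set Q in slots | [forall z in Q, c z == t]]|)%N.
Proof.
move=> tm cE.
have lt (l : 'I_y) : (t + l * m < y * m)%N.
  by apply: (@leq_trans (l.+1 * m)); rewrite ?leq_mul2r ?ltn_ord ?orbT // mulSn ltn_add2r.
pose f (l : 'I_y) := slot (Ordinal (lt l)).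
have fS l : f l \in slots by apply: imset_f.
rewrite -[leqLHS]card_ord -(@card_imset _ _ f); last first.
  move=> l l' ff; apply: val_inj => /=; apply/eqP; rewrite -(eqn_pmul2r m0) -(eqn_add2l t).
  have /card_gt0P[x xf] : (0 < #|f l|)%N by rewrite slots_card.
  have := slot_index xf; rewrite /f /= => <-; apply/eqP/slot_index.
  by rewrite -/(f l') -ff.
apply/subset_leq_card/fintype.subsetP => _ /imsetP[l _ ->]; rewrite inE fS /=.
apply/forall_inP => z zl; have zb : z \in band b (y * m * k).
  by apply: fintype.subsetP zl; exact: slots_band.
by rewrite cE // (slot_index zl) /= addnC modnMDl modn_small.
Qed.

End Layout.

(** * Exponential estimates *)

Section Numeric.
Variable R : realType.
Implicit Types (p lam e L gam : R).

Lemma expR_natM_le (x y : R) (N : nat) : 0 <= x -> N%:R <= y ->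
  expR x ^+ N <= expR (x * y).
Proof.
by move=> x0 Ny; rewrite -expRM_natl ler_expR mulrC ler_wpM2l.
Qed.

Lemma expRN_natM_le (x y z : R) (N : nat) : 0 <= z -> z <= expR (- x) -> 0 <= x ->
  y <= N%:R -> z ^+ N <= expR (- (x * y)).
Proof.
move=> z0 zx x0 yN; apply: (@le_trans _ _ (expR (- x) ^+ N)).
  by rewrite lerXn2r ?nnegrE ?expR_ge0.
by rewrite -expRM_natl ler_expR mulrN lerN2 mulrC ler_wpM2r.
Qed.

(** First t is taken so small that 1 - p + pt is at most (1 - p) exp(e lam / 4), then gam so small
    that t^(-N) is at most exp(e lam L / 2). The extra e L in the degree outweighs both losses. *)
Lemma numeric_B1B p lam e C : 0 < p -> p < 1 -> 1 - p = expR (- lam) -> 0 < lam ->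
  0 < e -> e <= 1 -> 0 < C ->
  exists t gam0, [/\ 0 < t, t < 1, 0 < gam0 &
    forall gam L (a : R) (d N : nat), 0 < gam -> gam <= gam0 -> 0 <= L -> 0 <= a ->
      a <= C * L -> N%:R <= gam * a -> (1 + e) * L <= d%:R ->
      t^-1 ^+ N * (1 - p + p * t) ^+ d <= expR (- (lam * L))].
Proof.
move=> p0 p1 plam lam0 e0 e1 C0.
pose t := Num.min 2^-1 (e * lam * (1 - p) / 4).
have t0 : 0 < t by rewrite lt_min invr_gt0 ltr0n !mulr_gt0 ?subr_gt0 ?invr_gt0.
have t1 : t < 1 by rewrite gt_min; apply/orP; left; lra.
have tle : t <= e * lam * (1 - p) / 4 by rewrite ge_min lexx orbT.
pose tau := ln t^-1.
have tau0 : 0 < tau by rewrite ln_gt0 // invf_gt1.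
have tauE : t^-1 = expR tau by rewrite lnK // posrE invr_gt0.
exists t, (e * lam / (2 * C * tau)); split=> //; first by rewrite !divr_gt0 ?mulr_gt0.
move=> gam L a d N g0 gle L0 a0 aC Na dL.
have h1 : t^-1 ^+ N <= expR (e * lam / 2 * L).
  rewrite tauE; apply: (le_trans (expR_natM_le (ltW tau0) Na)); rewrite ler_expR.
  have : gam * a <= e * lam / (2 * C * tau) * (C * L).
    by apply: ler_pM => //; exact: ltW.
  move=> /(ler_wpM2l (ltW tau0)) h; apply: (le_trans h).
  rewrite le_eqVlt; apply/orP; left; apply/eqP; field.
  by rewrite !gt_eqF.
pose x := lam - e * lam / 4.
have x0 : 0 <= x by rewrite /x; nra.
have h2 : (1 - p + p * t) ^+ d <= expR (- (x * ((1 + e) * L))).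
  apply: expRN_natM_le => //.
    by rewrite addr_ge0 ?subr_ge0 ?mulr_ge0 // ltW.
  have -> : - x = - lam + e * lam / 4 by rewrite /x; ring.
  rewrite expRD -plam.
  have := @expR_ge1Dx R (e * lam / 4).
  move=> /(ler_wpM2l (_ : 0 <= 1 - p)); rewrite subr_ge0 => /(_ (ltW p1)).
  apply: le_trans; nra.
apply: (@le_trans _ _ (expR (e * lam / 2 * L) * expR (- (x * ((1 + e) * L))))).
  apply: ler_pM => //; first by rewrite exprn_ge0 // invr_ge0 ltW.
  by rewrite exprn_ge0 // addr_ge0 ?subr_ge0 ?mulr_ge0 // ltW.
rewrite -expRD ler_expR.
(* The exact surplus in (1 - e/4)(1 + e) - e/2 >= 1; here e <= 1 enters. *)
have : 0 <= lam * L * (e * (1 - e) / 4).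
  by rewrite !mulr_ge0 ?subr_ge0 ?invr_ge0 // ltW.
by rewrite /x; nra.
Qed.

(** The power of 2 costs at most exp(p^2 a / 4), half of the exponent gained from the other
    factor. *)
Lemma numeric_BB p lam gam L (a N : nat) : 0 < p -> p < 1 -> 0 < gam ->
  gam <= p ^+ 2 / 4 -> 4 * lam / p ^+ 2 * L <= a%:R -> N%:R <= gam * a%:R ->
  2 ^+ N.+1 * (1 - p ^+ 2 / 2) ^+ a <= 2 * expR (- (lam * L)).
Proof.
move=> p0 p1 g0 gp aL Na; have p2 : 0 < p ^+ 2 by rewrite exprn_gt0.
have p21 : p ^+ 2 <= 1 by rewrite exprn_ile1 // ltW.
rewrite exprS -mulrA ler_wpM2l //.
have h1 : (2 : R) ^+ N <= expR (gam * a%:R).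
  apply: (@le_trans _ _ (expR 1 ^+ N)).
    by rewrite lerXn2r ?nnegrE ?expR_ge0 //; have := @expR_ge1Dx R 1; lra.
  by rewrite -[leRHS]/(expR (gam * a%:R)) -[gam * _]mul1r expR_natM_le.
have h2 : (1 - p ^+ 2 / 2) ^+ a <= expR (- (p ^+ 2 / 2 * a%:R)).
  apply: expRN_natM_le => //; [lra | exact: expR_ge1Dx | lra].
apply: (@le_trans _ _ (expR (gam * a%:R) * expR (- (p ^+ 2 / 2 * a%:R)))).
  by apply: ler_pM => //; rewrite exprn_ge0 //; lra.
rewrite -expRD ler_expR.
have : gam * a%:R <= p ^+ 2 / 4 * a%:R by rewrite ler_wpM2r.
have : p ^+ 2 / 4 * (4 * lam / p ^+ 2 * L) <= p ^+ 2 / 4 * a%:R.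
  by rewrite ler_wpM2l // divr_ge0 // ltW.
rewrite (_ : p ^+ 2 / 4 * (4 * lam / p ^+ 2 * L) = lam * L); last first.
  by field; rewrite gt_eqF.
by lra.
Qed.

End Numeric.

(** * The construction for fixed n *)

(** First moment method for a random subset of Q. *)
Lemma Ex_card_markov (R : realType) (T I : finType) (p : R) (D : {set T})
    (S : {set T} -> {set I}) (Q : {set I}) (b c eps : R) :
  0 <= p -> p <= 1 -> 0 < c -> (forall G : {set T}, G \subset D -> S G \subset Q) ->
  {in Q, forall q, Ex p D (fun G => (q \in S G)%:R) <= b} ->
  #|Q|%:R * b <= eps * c ->
  Ex p D (fun G => (c < #|S G|%:R)%R%:R) <= eps.
Proof.
move=> p0 p1 c0 SQ Sb Qb.
apply: (le_trans (Ex_markov p0 p1 c0 (f := fun G => #|S G|%:R) _)) => //.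
rewrite ler_pdivrMr //; apply: le_trans Qb.
rewrite (@eq_Ex _ _ _ _ _ (fun G => \sum_(q in Q) (q \in S G)%:R)).
  by rewrite Ex_sum mulr_natl -sumr_const; apply: ler_sum.
move=> G GD; rewrite -sum1_card natr_sum big_mkcond [RHS]big_mkcond /=.
apply: eq_bigr => q _; case: (boolP (q \in S G)) => [qS|_].
  by rewrite (fintype.subsetP (SQ G GD)).
by case: ifP.
Qed.

(** Z is the mean degree into A1 and Y a degree outside the window. Rounding of a1 shifts Z by at
    most 1 <= e L / 2, so the distance still exceeds e L / 4. *)
Lemma sqr_deviation (R : realType) (e L Y Z : R) :
  (1 + 2 * e) * L <= Z <= (1 + 2 * e) * L + 1 -> 2 <= e * L ->
  Y <= (1 + e) * L \/ (1 + 3 * e) * L < Y -> (e * L / 4) ^+ 2 < (Y - Z) ^+ 2.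
Proof.
have -> : (1 + 2 * e) * L = L + 2 * (e * L) by ring.
have -> : (1 + 3 * e) * L = L + 3 * (e * L) by ring.
have -> : (1 + e) * L = L + e * L by ring.
move: (e * L) => W /andP[d1 d2] W2 h.
rewrite -subr_gt0 subr_sqr; case: h => h.
  by rewrite nmulr_rgt0; lra.
by rewrite pmulr_rgt0; lra.
Qed.

(** The constant 9 is 3 from the upper end of the degree window plus 6 error terms. *)
Lemma edge_count_close (R : realType) (e x S w s3 q b4 b5 b6 h : R) :
  0 <= e * x -> S <= (1 + 3 * e) * x -> x <= S + q + w ->
  w <= e * x -> s3 <= e * x -> q <= e * x ->
  b4 <= e * x -> b5 <= e * x -> b6 <= e * x ->
  S <= h -> h <= S + w + s3 + q + b4 + b5 + b6 -> `| h - x | <= 9 * e * x.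
Proof.
have -> : (1 + 3 * e) * x = x + 3 * (e * x) by ring.
rewrite -(mulrA 9) ler_norml; move: (e * x) => E.
by move=> *; apply/andP; split; lra.
Qed.

Section Finite.
Variables (R : realType) (p : R) (n k a1 a2 y m : nat) (gam e L t : R).
Variables L1 L2 : {set {set 'I_n}}.

Let a3 := (y * m * k)%N.
Let A1 := band n 0 a1.
Let A2 := band n a1 a2.
Let A3 := band n (a1 + a2) a3.

(** Residues spread the colours evenly over A1 and A2; on A3 the slot index is reduced, so that a
    slot is monochromatic. *)
Definition colour (x : 'I_n) : nat :=
  if (x < a1 + a2)%N then (x %% m)%N else ((x - (a1 + a2)) %/ k %% m)%N.

Let c := colour.

(** The part of the labelling that does not depend on G: 3 stands for all of B, which [lab] splits
    by degree into A1. *)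
Let base (x : 'I_n) : nat :=
  if (x < a1)%N then 0%N else if (x < a1 + a2)%N then 1%N
  else if (x < a1 + a2 + a3)%N then 2%N else 3%N.

Let good (G : {set {set 'I_n}}) u :=
  (1 + e) * L < #|nbr G u :&: A1|%:R <= (1 + 3 * e) * L.

Let lab G x := if (base x < 3)%N then base x else if good G x then 3%N else 4%N.

Let F (i : nat) : {set {set 'I_n}} :=
  if i is 0 then L1 else if i is 1 then L2 else slots n (a1 + a2) k y m.

Let sparse_in (A : {set 'I_n}) (M : {set {set 'I_n}}) (G : {set {set 'I_n}}) := [exists (S : {set 'I_n} |
   (S \subset A) && (gam * #|A|%:R <= #|S|%:R)),
   ~~ [exists Q in M, (Q \subset S) && (edges_in Q \subset G)]].

Let nL : R := n%:R * L.

Hypothesis an : (a1 + a2 + a3 <= n)%N.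

Let cA1 : #|A1| = a1. Proof. by rewrite card_band //; lia. Qed.
Let cA2 : #|A2| = a2. Proof. by rewrite card_band //; lia. Qed.
Let cA3 : #|A3| = a3. Proof. by rewrite card_band. Qed.

Let A1P x : (x \in A1) = (base x == 0%N).
Proof. by rewrite inE /base; do !case: ltnP => ? //; lia. Qed.
Let A2P x : (x \in A2) = (base x == 1%N).
Proof. by rewrite inE /base; do !case: ltnP => ? //; lia. Qed.
Let A3P x : (x \in A3) = (base x == 2%N).
Proof. by rewrite inE /base; do !case: ltnP => ? //; lia. Qed.

Let lab_base G i x : (i < 3)%N -> (lab G x == i) = (base x == i).
Proof.
rewrite /lab; case: ifP => // b3 i3.
have -> : (base x == i) = false by apply: contraFF b3 => /eqP ->.
by case: ifP => _; move: i3; case: (i) => [|[|[|]]].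
Qed.

Let clsE G : [/\ cls (lab G) 0 = A1, cls (lab G) 1 = A2 & cls (lab G) 2 = A3].
Proof.
by split; apply/setP => x; rewrite inE lab_base // ?A1P ?A2P ?A3P.
Qed.

Let lab_gt2 G x : (2 < lab G x)%N = (2 < base x)%N.
Proof.
by rewrite /lab; case: (ltnP (base x) 3) => b3; [lia | case: ifP => _; lia].
Qed.

Let base_notin x : (2 < base x)%N -> [/\ x \notin A1, x \notin A2 & x \notin A3].
Proof. by rewrite A1P A2P A3P => b; split; apply: contraTneq b => ->. Qed.

Let lab3 G x : (lab G x == 3%N) = (2 < base x)%N && good G x.
Proof.
by rewrite /lab; case: (ltnP (base x) 3) => b3 /=; [lia | case: ifP].
Qed.

Let lab4 G x : (lab G x == 4%N) = (2 < base x)%N && ~~ good G x.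
Proof.
by rewrite /lab; case: (ltnP (base x) 3) => b3 /=; [lia | case: ifP].
Qed.

Hypotheses (p0 : 0 < p) (p1 : p < 1) (k0 : (0 < k)%N) (m0 : (0 < m)%N).
Hypotheses (e0 : 0 < e) (gam0 : 0 < gam).
Hypotheses (t0 : 0 < t) (t1 : t < 1).
Hypothesis L1P : forall Q, Q \in L1 -> [/\ Q \subset A1, #|Q| = k & {in Q &, injective c}].
Hypothesis L2P : forall Q, Q \in L2 -> [/\ Q \subset A2, #|Q| = k & {in Q &, injective c}].
Hypotheses (L1cl : clique_bound k L1) (L2cl : clique_bound k L2).
Hypothesis L1E : Ex p (vpairs 'I_n) (fun G => (sparse_in A1 L1 G)%:R) <= e.
Hypothesis L2E : Ex p (vpairs 'I_n) (fun G => (sparse_in A2 L2 G)%:R) <= e.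
Hypothesis hB1B : forall d N : nat, N%:R <= gam * a1%:R -> (1 + e) * L <= d%:R ->
  t^-1 ^+ N * (1 - p + p * t) ^+ d <= n%:R^-1.
Hypothesis hBB : forall N : nat, N%:R <= gam * a2%:R ->
  2 ^+ N.+1 * (1 - p ^+ 2 / 2) ^+ a2 <= 2 * n%:R^-1.
Hypothesis hslot : a2%:R * n%:R * (2 * (1 - p ^+ (2 ^ k.+2) / 2) ^+ y) <= e * (e * nL).
Hypothesis hdev : (1 + 2 * e) * L <= p * a1%:R <= (1 + 2 * e) * L + 1.
Hypothesis eL : 2 <= e * L.
Hypothesis hW : n%:R * (a1%:R / (e * L / 4) ^+ 2) <= e * (e * nL / (a1%:R + a2%:R)).
Hypothesis hn : 2 * n%:R <= e * (e * nL).
Hypothesis ha3 : a3%:R * n%:R <= e * nL.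
Hypothesis hA : (a1%:R + a2%:R + a3%:R) ^+ 2 <= e * nL.
Hypotheses (L1le : 1 <= L) (aL : L <= a1%:R).

Let L0 : 0 < L. Proof. exact: lt_le_trans L1le. Qed.
Let a1R : 0 < a1%:R :> R. Proof. exact: lt_le_trans aL. Qed.
Let nR : 0 < n%:R :> R.
Proof. by rewrite ltr0n; apply: leq_trans an; rewrite -addnA ltn_addr // -(ltr0n R). Qed.
Let nL0 : 0 < nL. Proof. by rewrite mulr_gt0. Qed.
Let enL0 : 0 < e * nL. Proof. by rewrite mulr_gt0. Qed.

(** Each failure means that one error term exceeds e n L edges; a vertex of W accounts for up to a1
    + a2 of them, hence the quotient. *)
Let low G := e * nL / (a1%:R + a2%:R) < #|cls (lab G) 4|%:R.
Let bad4 G := e * nL < #|bad_A2B G (lab G) c F|%:R.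
Let bad5 G := e * nL < #|bad_B1B G (lab G) gam|%:R.
Let bad6 G := e * nL < #|bad_BB G (lab G) gam|%:R.

Let Exp := Ex p (vpairs 'I_n).
Let p0' : 0 <= p. Proof. exact: ltW. Qed.
Let p1' : p <= 1. Proof. exact: ltW. Qed.

(** Chebyshev's inequality at each vertex of B, then the first moment method. *)
Let low_le : Exp (fun G => (low G)%:R) <= e.
Proof.
apply: (Ex_card_markov (Q := [set: 'I_n]) (b := a1%:R / (e * L / 4) ^+ 2)) => //.
- by rewrite divr_gt0 // ltr_wpDr.
- move=> u _; case: (ltnP (base u) 3) => b3.
    rewrite (@eq_Ex _ _ _ _ _ (fun=> 0)) ?Ex_cst; last first.
      by move=> G _; rewrite inE lab4 ltnNge -ltnS b3.
    by rewrite divr_ge0 // ?sqr_ge0 // ltW.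
  have [uA _ _] := base_notin b3.
  have tt : 0 < e * L / 4 by rewrite divr_gt0 // mulr_gt0.
  have := degree_deviation p0 p1 uA tt; rewrite cA1; apply: le_trans.
  apply: le_Ex => // G _; rewrite inE lab4 b3 /= /good.
  case: (boolP (_ < _ <= _)) => //= ng; set X := #|_|%:R - _.
  suff -> : (e * L / 4) ^+ 2 < X ^+ 2 by [].
  by apply: sqr_deviation => //; apply/orP; move: ng; rewrite negb_and -leNgt -ltNge.
by rewrite cardsT card_ord.
Qed.

Let bad4_le : Exp (fun G => (bad4 G)%:R) <= e.
Proof.
apply: (Ex_card_markov (Q := setX A2 [set: 'I_n])
          (b := 2 * (1 - p ^+ (2 ^ k.+2) / 2) ^+ y)) => //.
- move=> G _; apply/fintype.subsetP => -[x u]; rewrite in_setX in_setT andbT in_set /=.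
  by rewrite lab_base // -A2P => /andP[].
- move=> [x u] /setXP[/= xA _].
  have b2 : 0 <= 2 * (1 - p ^+ (2 ^ k.+2) / 2) ^+ y.
    rewrite mulr_ge0 // exprn_ge0 // subr_ge0.
    by rewrite ler_pdivrMr // mul1r (@le_trans _ _ 1) ?exprn_ile1 ?ler1n.
  case: (ltnP (base u) 3) => b3.
    rewrite (@eq_Ex _ _ _ _ _ (fun=> 0)) ?Ex_cst // => G _.
    by rewrite inE /= lab_gt2 [(2 < base u)%N]ltnNge -ltnS b3 andbF.
  have [_ uA2 uA3] := base_notin b3.
  have xu : x != u by apply: contraNneq uA2 => <-.
  have xA3 : x \notin A3 by move: xA; rewrite A2P A3P => /eqP ->.
  apply: le_trans (no_slot_prob (L := F) (c := c) (k := k) (y := y) p0 p1 xu _ _ _).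
  + by apply: le_Ex => // G _; rewrite inE /= ler_nat; case: (lab _ _ == _) => //; case: (2 < _)%N.
  + move=> Q QL; split; last exact: slots_card QL.
      by apply: contra xA3; apply: fintype.subsetP; apply: slots_band QL.
    by apply: contra uA3; apply: fintype.subsetP; apply: slots_band QL.
  + exact: slots_disjoint.
  + apply: slots_colour => //.
      rewrite /c /colour; move: xA; rewrite inE => /andP[_ ->]; exact: ltn_pmod.
    by move=> z; rewrite inE /c /colour => /andP[bz _]; rewrite ltnNge bz.
by rewrite cardsX cA2 cardsT card_ord natrM.
Qed.

(** Only the first end u is known to have large degree into A1. A pair is bad with probability at
    most 1/n, so at most n bad pairs are expected. *)
Let bad5_le : Exp (fun G => (bad5 G)%:R) <= e.
Proof.
apply: (Ex_card_markov (Q := [set: 'I_n * 'I_n]) (b := n%:R^-1)) => //.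
- move=> [u v] _.
  case: (boolP [&& (2 < base u)%N, (2 < base v)%N & u != v]) => [/and3P[bu bv uv]|nb]; last first.
    rewrite (@eq_Ex _ _ _ _ _ (fun=> 0)) ?Ex_cst ?invr_ge0 // => G _.
    apply/eqP; rewrite pnatr_eq0 eqb0; apply: contra nb; rewrite inE /= lab3 lab_gt2.
    by case/and4P => /andP[-> _] -> ->.
  have [uA _ _] := base_notin bu; have [vA _ _] := base_notin bv.
  (* Integer thresholds: a degree above (1 + e) L is at least d, and a codegree below gam a1 is at
     most N. *)
  pose d := (Num.truncn ((1 + e) * L)).+1; pose N := Num.truncn (gam * a1%:R).
  have ga : 0 <= gam * a1%:R by rewrite mulr_ge0 // ltW.
  have eL0 : 0 <= (1 + e) * L by rewrite mulr_ge0 ?(ltW L0) // addr_ge0 // ltW.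
  have dE : (1 + e) * L <= d%:R by apply: ltW; apply: truncnS_gt.
  have NE : N%:R <= gam * a1%:R by rewrite truncn_le.
  apply: le_trans (hB1B NE dE).
  apply: le_trans (high_degree_low_codegree p0 p1 uv uA vA d N t0 t1).
  apply: le_Ex => // G _; rewrite ler_nat inE /= lab3 /good /few_common.
  have [-> _ _] := clsE G; rewrite cA1.
  case: (boolP [&& _, _, _ & _]) => // /and4P[/andP[_ /andP[dg _]] _ _ cg].
  rewrite -truncn_lt_nat // in dg.
  suff -> : (#|nbr G u :&: nbr G v :&: A1| <= N)%N by rewrite dg.
  by rewrite /N truncn_ge_nat // ltW.
rewrite cardsT card_prod card_ord natrM mulfK ?gt_eqF //.
by apply: le_trans hn; rewrite ler_peMl ?ler1n // ltW.
Qed.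

Let bad6_le : Exp (fun G => (bad6 G)%:R) <= e.
Proof.
apply: (Ex_card_markov (Q := [set: 'I_n * 'I_n]) (b := 2 * n%:R^-1)) => //.
- move=> [u v] _.
  case: (boolP [&& (2 < base u)%N, (2 < base v)%N & u != v]) => [/and3P[bu bv uv]|nb]; last first.
    rewrite (@eq_Ex _ _ _ _ _ (fun=> 0)) ?Ex_cst ?mulr_ge0 ?invr_ge0 // => G _.
    apply/eqP; rewrite pnatr_eq0 eqb0; apply: contra nb; rewrite inE /= !lab_gt2.
    by case/and4P => -> -> ->.
  have [_ uA _] := base_notin bu; have [_ vA _] := base_notin bv.
  pose N := Num.truncn (gam * a2%:R).
  have ga : 0 <= gam * a2%:R by rewrite mulr_ge0 // ltW.
  have NE : N%:R <= gam * a2%:R by rewrite truncn_le.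
  apply: le_trans (hBB NE); rewrite -cA2.
  apply: le_trans (low_codegree p0 p1 uv uA vA N.+1).
  apply: le_Ex => // G _; rewrite ler_nat inE /= /few_common.
  have [_ -> _] := clsE G; rewrite cA2.
  case: (boolP [&& _, _, _ & _]) => // /and4P[_ _ _ cg].
  suff -> : (#|nbr G u :&: nbr G v :&: A2| < N.+1)%N by [].
  by rewrite ltnS /N truncn_ge_nat // ltW.
by rewrite cardsT card_prod card_ord natrM mulrCA mulfK ?gt_eqF.
Qed.

(** Each vertex of B1 has between L and (1 + 3e) L neighbours in A1. The L edges missing for every
    other vertex are absorbed by the error terms, because L <= a1. *)
Let good_event (G : {set {set 'I_n}}) : G \subset vpairs 'I_n ->
  ~~ [|| sparse_in A1 L1 G, sparse_in A2 L2 G, low G, bad4 G, bad5 G | bad6 G] ->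
  [exists H : {set {set 'I_n}}, K_saturated k.+2 G H &&
     (`| #|H|%:R - nL | <= 9 * e * nL)].
Proof.
move=> GV; rewrite !negb_or => /and5P[d1 d2 nlow n4 /andP[n5 n6]].
have labE i x : (i < 3)%N -> base x = i -> lab G x = i.
  by move=> i3 bx; apply/eqP; rewrite lab_base // bx.
have lab5 x : (lab G x < 5)%N.
  by rewrite /lab; case: ifP => [b3|_]; [apply: leq_trans b3 _ | case: ifP].
have Lk i (Q : {set 'I_n}) : (i < 3)%N -> Q \in F i -> #|Q| = k /\ {in Q, forall x, lab G x = i}.
  case: i => [|[|[|//]]] i3 QF.
  - have [QA -> _] := L1P QF; split=> // x /(fintype.subsetP QA).
    by rewrite A1P => /eqP; apply: labE.
  - have [QA -> _] := L2P QF; split=> // x /(fintype.subsetP QA).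
    by rewrite A2P => /eqP; apply: labE.
  - split=> [|x]; first exact: slots_card QF.
    have QA : Q \subset A3 by apply: slots_band QF.
    by move/(fintype.subsetP QA); rewrite A3P => /eqP; apply: labE.
have L1c (Q : {set 'I_n}) : Q \in F 1 -> {in Q &, injective c} by case/L2P.
have Lcl i : (i < 3)%N -> clique_bound k (F i).
  by case: i => [|[|[|//]]] _ //; exact: slots_clique_bound.
have [c0 c1 c2] := clsE G.
have dense i (S : {set 'I_n}) : (i < 2)%N -> S \subset cls (lab G) i ->
    gam * #|cls (lab G) i|%:R <= #|S|%:R ->
    exists2 Q : {set 'I_n}, Q \in F i & (Q \subset S) && (edges_in Q \subset G).
  case: i => [|[|//]] _; rewrite ?c0 ?c1 => SA SD; apply/exists_inP.
    by apply: contraNT d1 => nQ; apply/exists_inP; exists S; rewrite ?SA.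
  by apply: contraNT d2 => nQ; apply/exists_inP; exists S; rewrite ?SA.
have [H [Hs lb ub]] := template_saturated GV lab5 Lk L1c Lcl dense.
rewrite c0 c1 c2 cA1 cA2 cA3 in lb ub.
set S := (\sum_(u in _) _)%N in lb ub.
have SE : S%:R = \sum_(u in cls (lab G) 3) #|nbr G u :&: A1|%:R :> R.
  by rewrite /S natr_sum.
have Sup : S%:R <= #|cls (lab G) 3|%:R * ((1 + 3 * e) * L).
  rewrite SE mulr_natl -sumr_const; apply: ler_sum => u.
  by rewrite inE lab3 => /and3P[].
have Slo : #|cls (lab G) 3|%:R * L <= S%:R.
  rewrite SE mulr_natl -sumr_const; apply: ler_sum => u.
  rewrite inE lab3 => /and3P[_ /ltW lu _]; apply: le_trans lu.
  by rewrite mulrDl mul1r lerDl mulr_ge0 // ltW.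
have part : (n <= a1 + a2 + a3 + #|cls (lab G) 3| + #|cls (lab G) 4|)%N.
  rewrite -[leqLHS]card_ord -cardsT -cA1 -cA2 -cA3 -c0 -c1 -c2.
  apply: (@leq_trans #|cls (lab G) 0 :|: cls (lab G) 1 :|: cls (lab G) 2 :|:
                      cls (lab G) 3 :|: cls (lab G) 4|).
    apply/subset_leq_card/fintype.subsetP => x _; rewrite !inE.
    by move: (lab5 x); case: (lab G x) => [|[|[|[|[|]]]]].
  do 3!(apply: leq_trans (leq_card_setU _ _) _; rewrite leq_add2r).
  exact: leq_card_setU.
have c3n : #|cls (lab G) 3|%:R <= n%:R :> R.
  by rewrite ler_nat -[leqRHS]card_ord max_card.
have a12 : 0 < a1%:R + a2%:R :> R by rewrite ltr_wpDr.
have wle : #|cls (lab G) 4|%:R * (a1%:R + a2%:R) <= e * nL.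
  by move: nlow; rewrite /low -leNgt ler_pdivlMr.
apply/existsP; exists H; rewrite Hs /=.
apply: (edge_count_close (S := S%:R) (w := #|cls (lab G) 4|%:R * (a1%:R + a2%:R))
  (s3 := a3%:R * n%:R) (q := (a1%:R + a2%:R + a3%:R) ^+ 2)
  (b4 := #|bad_A2B G (lab G) c F|%:R) (b5 := #|bad_B1B G (lab G) gam|%:R)
  (b6 := #|bad_BB G (lab G) gam|%:R)); rewrite ?ler_nat //; try by rewrite leNgt.
- exact: ltW.
- apply: (le_trans Sup); rewrite mulrCA; apply: ler_wpM2l.
    by rewrite addr_ge0 // mulr_ge0 // ltW.
  by rewrite /nL ler_wpM2r // ltW.
- apply: (@le_trans _ _ ((a1 + a2 + a3 + #|cls (lab G) 3| + #|cls (lab G) 4|)%N%:R * L)).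
    by rewrite /nL ler_wpM2r ?ler_nat // ltW.
  have -> : (a1 + a2 + a3 + #|cls (lab G) 3| + #|cls (lab G) 4|)%N%:R * L =
      #|cls (lab G) 3|%:R * L + (a1%:R + a2%:R + a3%:R) * L + #|cls (lab G) 4|%:R * L.
    by rewrite !natrD; ring.
  have h1 : (a1%:R + a2%:R + a3%:R) * L <= (a1%:R + a2%:R + a3%:R) ^+ 2.
    rewrite expr2 ler_wpM2l ?addr_ge0 // (le_trans aL) // -addrA lerDl.
    by rewrite addr_ge0.
  have h2 : #|cls (lab G) 4|%:R * L <= #|cls (lab G) 4|%:R * (a1%:R + a2%:R).
    by rewrite ler_wpM2l // (le_trans aL) // lerDl.
  by rewrite !lerD.
rewrite -!natrD -!natrM -natrX -!natrD ler_nat; move: ub.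
by rewrite card_ord.
Qed.

(** The indicator of success is at least 1 minus the number of failures, and at most 6e failures are
    expected. *)
Lemma template_whp : 1 - 6 * e <= gnp_prob p (fun G : {set {set 'I_n}} =>
  [exists H : {set {set 'I_n}}, K_saturated k.+2 G H &&
     (`| #|H|%:R - nL | <= 9 * e * nL)]).
Proof.
have -> : forall P : pred {set {set 'I_n}}, gnp_prob p P = Exp (fun G => (P G)%:R).
  move=> P; rewrite /gnp_prob /Exp /Ex big_mkcondr /=; apply: eq_bigr => G _.
  by rewrite /gnp_mass /submass; case: (P G); rewrite ?mulr1 ?mulr0.
pose fail G := ((sparse_in A1 L1 G)%:R + (sparse_in A2 L2 G)%:R + (low G)%:R +
   (bad4 G)%:R + (bad5 G)%:R + (bad6 G)%:R : R).
have Ef : Exp fail <= 6 * e.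
  rewrite /Exp /fail !ExD.
  move: L1E L2E low_le bad4_le bad5_le bad6_le; rewrite /Exp.
  by do !move: (Ex _ _ _) => ?; lra.
apply: (@le_trans _ _ (Exp (fun G => 1 + (-1) * fail G))).
  by rewrite /Exp ExD ExZ Ex_cst mulN1r lerD2l lerN2.
apply: le_Ex => // G GV; rewrite mulN1r lerBlDr.
case: (boolP [|| sparse_in A1 L1 G, sparse_in A2 L2 G, low G, bad4 G, bad5 G | bad6 G]).
  move=> fl; apply: ler_wpDl => //; rewrite /fail -!natrD ler1n.
  by case/or4P: fl => [->|->|->|/or3P[]->]; rewrite // ?addnA !addn_gt0 ?orbT.
by move=> /(good_event GV) ->; rewrite lerDl /fail !addr_ge0.
Qed.

End Finite.

(** * Choice of the constants *)

Lemma saturated_whp (R : realType) (p : R) (k : nat) (e : R) :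
  0 < p -> p < 1 -> (0 < k)%N -> 0 < e -> e <= 1 ->
  exists N0, forall n, (N0 <= n)%N ->
    1 - 6 * e <= gnp_prob p (fun G : {set {set 'I_n}} =>
      [exists H : {set {set 'I_n}}, K_saturated k.+2 G H &&
        (`| #|H|%:R - n%:R * logb (1 / (1 - p)) n%:R |
           <= 9 * e * (n%:R * logb (1 / (1 - p)) n%:R))]).
Proof.
move=> p0 p1 k0 e0 e1.
pose lam := ln (1 / (1 - p)).
have q0 : 0 < 1 - p by rewrite subr_gt0.
have lam0 : 0 < lam by rewrite ln_gt0 // div1r invf_gt1 // gtrBl.
have plam : 1 - p = expR (- lam).
  by rewrite expRN lnK ?div1r ?invrK // posrE invr_gt0.
(* With a1 close to C1 L the mean degree p a1 is the middle of the window; C2 is what codegrees into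
   A2 require. *)
pose C1 := (1 + 2 * e) / p; pose C2 := 4 * lam / p ^+ 2.
have p2 : 0 < p ^+ 2 by rewrite exprn_gt0.
have C1_1 : 1 <= C1.
  rewrite ler_pdivlMr // mul1r (le_trans (ltW p1)) // lerDl mulr_ge0 //; exact: ltW.
have C1_0 : 0 < C1 by apply: lt_le_trans C1_1.
have C2_0 : 0 < C2 by rewrite divr_gt0 // mulr_gt0.
have C1_2 : 0 < 2 * C1 by rewrite mulr_gt0.
(* The factor 2 absorbs the rounding in a1 <= 2 C1 L. *)
have [t [gam0 [t0 t1 gam00 hB1B]]] := numeric_B1B p0 p1 plam lam0 e0 e1 C1_2.
pose gam := Num.min gam0 (p ^+ 2 / 4).
have gam_gt0 : 0 < gam by rewrite lt_min gam00 divr_gt0.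
have gam_le : gam <= gam0 by rewrite ge_min lexx.
have gam_le2 : gam <= p ^+ 2 / 4 by rewrite ge_min lexx orbT.
(* Here 2 k^2 = gam K / 2, so m >= K colours and a >= K vertices give 2 k^2 (a/m + 1) <= gam a, half
   from each summand. *)
pose K := 4 * (k ^ 2)%:R / gam.
have K0 : 0 <= K by rewrite divr_ge0 ?mulr_ge0 // ltW.
pose m := (Num.truncn K).+1.
have Km : K <= m%:R by apply/ltW/truncnS_gt.
pose dl := p ^+ (2 ^ k.+2) / 2.
have pk : p ^+ (2 ^ k.+2) <= 1 by rewrite exprn_ile1 // ltW.
have dl0 : 0 < dl by rewrite divr_gt0 ?exprn_gt0.
have dl1 : dl <= 1 by rewrite ler_pdivrMr // mul1r (le_trans pk) // ler1n.
(* With a2 <= 2 C2 L this bounds the expected number of bad A2-B pairs by e^2 n L. *)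
have [y _ yP] : exists2 y : nat, (0 < y)%N & (1 - dl) ^+ y <= e ^+ 2 / (4 * C2).
  apply: exists_expr_le; rewrite ?subr_ge0 ?gtrBl //.
  by apply: divr_gt0; [exact: exprn_gt0 | exact: mulr_gt0].
pose a3 := (y * m * k)%N.
have [a0 a0P] := exists_blocks p0 p1 k0 gam_gt0 e0.
pose C4 := 2 * (C1 + C2) + 1.
have C4_1 : 1 <= C4 by rewrite /C4 lerDr mulr_ge0 // addr_ge0 // ltW.
have C4_0 : 0 < C4 by apply: lt_le_trans C4_1.
(* All lower bounds that L must satisfy; the sum of their absolute values dominates each of them,
   and n > exp(lam L0) gives L >= L0. *)
pose s := [:: 1; C2^-1; a0%:R; a0%:R / C2; K; K / C2; a3%:R; a3%:R / e; 2 / e;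
  2 / e ^+ 2; 64 * C1 * (C1 + C2) / e ^+ 4; 2 * C4 ^+ 2 / (e * lam ^+ 2)].
pose L0 := \sum_(x <- s) `|x|.
exists (Num.truncn (expR (lam * L0))).+1 => n n_ge.
have nE : expR (lam * L0) < n%:R.
  by apply: lt_le_trans (truncnS_gt _) _; rewrite ler_nat.
have n0 : 0 < n%:R :> R by apply: le_lt_trans nE; exact: expR_ge0.
pose L := logb (1 / (1 - p)) n%:R.
have lamL : lam * L = ln n%:R by rewrite /L /logb -/lam mulrC divfK // gt_eqF.
have LL0 : L0 <= L.
  by rewrite -(ler_pM2l lam0) lamL -[leLHS]expRK ler_ln ?posrE ?expR_gt0 // ltW.
have Ls x : x \in s -> x <= L.
  move=> xs; apply: le_trans LL0; apply: le_trans (ler_norm _) _.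
  rewrite /L0 (big_rem x) //= lerDl; apply: sumr_ge0 => *; exact: normr_ge0.
have nlamL : n%:R = expR (lam * L) by rewrite lamL lnK.
have L1 : 1 <= L by apply: Ls; rewrite !inE eqxx ?orbT.
have LC2 : 1 <= C2 * L.
  by rewrite mulrC -ler_pdivrMr // div1r; apply: Ls; rewrite !inE eqxx ?orbT.
have La0 : a0%:R <= L by apply: Ls; rewrite !inE eqxx ?orbT.
have La0' : a0%:R <= C2 * L.
  by rewrite mulrC -ler_pdivrMr //; apply: Ls; rewrite !inE eqxx ?orbT.
have LK : K <= L by apply: Ls; rewrite !inE eqxx ?orbT.
have LK' : K <= C2 * L.
  by rewrite mulrC -ler_pdivrMr //; apply: Ls; rewrite !inE eqxx ?orbT.
have La3 : a3%:R <= L by apply: Ls; rewrite !inE eqxx ?orbT.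
have La3' : a3%:R <= e * L.
  by rewrite mulrC -ler_pdivrMr //; apply: Ls; rewrite !inE eqxx ?orbT.
have Le : 2 <= e * L.
  by rewrite mulrC -ler_pdivrMr //; apply: Ls; rewrite !inE eqxx ?orbT.
have Le2 : 2 <= e ^+ 2 * L.
  by rewrite mulrC -ler_pdivrMr ?exprn_gt0 //; apply: Ls; rewrite !inE eqxx ?orbT.
have LW : 64 * C1 * (C1 + C2) <= e ^+ 4 * L.
  by rewrite [leRHS]mulrC -ler_pdivrMr ?exprn_gt0 //; apply: Ls; rewrite !inE eqxx ?orbT.
have LC4 : 2 * C4 ^+ 2 <= e * lam ^+ 2 * L.
  rewrite [leRHS]mulrC -ler_pdivrMr ?mulr_gt0 ?exprn_gt0 //.
  by apply: Ls; rewrite !inE eqxx ?orbT.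
have L_0 : 0 < L by apply: lt_le_trans L1.
pose a1 := (Num.truncn (C1 * L)).+1; pose a2 := (Num.truncn (C2 * L)).+1.
have C1L : 0 <= C1 * L by rewrite mulr_ge0 // ltW.
have C2L : 0 <= C2 * L by rewrite mulr_ge0 // ltW.
have a1_ge : C1 * L <= a1%:R by apply/ltW/truncnS_gt.
have a2_ge : C2 * L <= a2%:R by apply/ltW/truncnS_gt.
have a1_le1 : a1%:R <= C1 * L + 1.
  by rewrite /a1 -natr1 lerD2r truncn_le.
have C1L1 : L <= C1 * L by rewrite ler_peMl // ltW.
have a1_le : a1%:R <= 2 * C1 * L by lra.
have a2_le : a2%:R <= 2 * C2 * L.
  have : a2%:R <= C2 * L + 1 by rewrite /a2 -natr1 lerD2r truncn_le.
  by lra.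
have aC4 : a1%:R + a2%:R + a3%:R <= C4 * L by rewrite /C4; lra.
(* From exp(x) >= x^2 / 2 at x = lam L = ln n. *)
have C4n : C4 ^+ 2 * L <= e * n%:R.
  have nL2 : (lam * L) ^+ 2 / 2 <= n%:R.
    have := @expR_ge1Dxn R (lam * L) 1 (ltW (mulr_gt0 lam0 L_0)).
    by rewrite -nlamL (_ : (2`! = 2)%N) //; lra.
  have : 2 * C4 ^+ 2 * L <= e * lam ^+ 2 * L * L by rewrite ler_wpM2r // ltW.
  have : e * ((lam * L) ^+ 2 / 2) <= e * n%:R by rewrite ler_wpM2l // ltW.
  by rewrite exprMn; lra.
have C4Ln : C4 * L <= n%:R.
  apply: (@le_trans _ _ (C4 ^+ 2 * L)).
    by rewrite ler_wpM2r ?(ltW L_0) // expr2 ler_peMl // ltW.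
  by apply: (le_trans C4n); rewrite ler_piMl // ltW.
have an : (a1 + a2 + a3 <= n)%N.
  by rewrite -(ler_nat R) !natrD (le_trans aC4).
have blk b a : (b + a <= a1 + a2)%N -> a0%:R <= a%:R :> R -> K <= a%:R ->
  exists M : {set {set 'I_n}},
    [/\ forall Q, Q \in M -> [/\ Q \subset band n b a, #|Q| = k &
            {in Q &, injective (@colour n k a1 a2 m)}],
        clique_bound k M &
        Ex p (vpairs 'I_n) (fun G => [exists (S : {set 'I_n} |
            (S \subset band n b a) && (gam * #|band n b a|%:R <= #|S|%:R)),
          ~~ [exists Q in M, (Q \subset S) && (edges_in Q \subset G)]]%:R) <= e].
  move=> ba aa Ka.
  have cba : #|band n b a| = a.
    by rewrite card_band //; apply: leq_trans ba _; apply: leq_trans an; apply: leq_addr.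
  apply: (a0P _ (band n b a) (@colour n k a1 a2 m) (a %/ m).+1); rewrite ?cba.
  - by rewrite -(ler_nat R).
  - move=> i; apply: leq_trans (card_residue n b a i (isT : (0 < m)%N)).
    apply/subset_leq_card/fintype.subsetP => x; rewrite !inE /colour.
    by move=> /andP[/andP[-> xa]]; rewrite xa (leq_trans xa ba).
  rewrite natrM -natr1 mulrDr mulr1.
  have kK : (2 * k ^ 2)%N%:R = gam * K / 2.
    by rewrite /K natrM; field; rewrite gt_eqF.
  have h1 : (2 * k ^ 2)%N%:R <= gam * a%:R / 2.
    by rewrite kK ler_wpM2r // ler_wpM2l // ltW.
  have h2 : (2 * k ^ 2)%N%:R * (a %/ m)%N%:R <= gam * a%:R / 2.
    rewrite kK mulrAC ler_wpM2r // -mulrA ler_wpM2l ?(ltW gam_gt0) //.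
    apply: (@le_trans _ _ (m%:R * (a %/ m)%N%:R)); first by rewrite ler_wpM2r.
    by rewrite -natrM ler_nat mulnC leq_trunc_div.
  by lra.
have [M1 [M1P M1cl M1E]] : _ := blk 0%N a1 (leq_addr _ _)
  (le_trans La0 (le_trans C1L1 a1_ge)) (le_trans LK (le_trans C1L1 a1_ge)).
have [M2 [M2P M2cl M2E]] : _ := blk a1 a2 (leqnn _)
  (le_trans La0' a2_ge) (le_trans LK' a2_ge).
have nV : n%:R^-1 = expR (- (lam * L)) by rewrite expRN -nlamL.
apply: (template_whp (a1 := a1) (a2 := a2) (y := y) (m := m) (gam := gam) (t := t)
          (L1 := M1) (L2 := M2)) => //; rewrite -/L.
- move=> d N Na dL; rewrite nV; apply: (hB1B gam L a1%:R) => //; exact: ltW.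
- move=> N Na; rewrite nV; exact: (numeric_BB p0 p1 gam_gt0 gam_le2 a2_ge Na).
- apply: (@le_trans _ _ (2 * C2 * L * n%:R * (2 * (e ^+ 2 / (4 * C2))))).
    apply: ler_pM => //; rewrite ?mulr_ge0 //.
    + by rewrite exprn_ge0 // subr_ge0.
    + by rewrite ler_wpM2r // ltW.
    + by rewrite ler_wpM2l.
  rewrite le_eqVlt; apply/orP; left; apply/eqP; field.
  by rewrite gt_eqF.
- have pC : p * (C1 * L) = (1 + 2 * e) * L by rewrite /C1; field; rewrite gt_eqF.
  have : p * (C1 * L) <= p * a1%:R by rewrite ler_wpM2l // ltW.
  have : p * a1%:R <= p * (C1 * L + 1) by rewrite ler_wpM2l // ltW.
  by rewrite mulrDr pC mulr1 => h ->; lra.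
(* W has expected size O(n/L) and each of its vertices costs O(L) edges, so the loss is O(n). *)
- have a12 : 0 < a1%:R + a2%:R :> R by rewrite ltr_wpDr.
  have D0 : 0 < (e * L / 4) ^+ 2.
    by rewrite exprn_gt0 // divr_gt0 // mulr_gt0.
  rewrite [leRHS]mulrA ler_pdivlMr // [n%:R * _]mulrA [leLHS]mulrAC ler_pdivrMr //.
  have : a1%:R * (a1%:R + a2%:R) <= (2 * C1 * L) * (2 * (C1 + C2) * L).
    by apply: ler_pM => //; lra.
  move=> /(ler_wpM2l (ltW n0)) h; rewrite -[leLHS]mulrA; apply: (le_trans h).
  have : 0 <= n%:R * L ^+ 2 / 16.
    by apply: divr_ge0 => //; apply: mulr_ge0 (ltW n0) (sqr_ge0 _).
  move=> /ler_wpM2l /(_ _ _ LW).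
  rewrite (_ : n%:R * L ^+ 2 / 16 * (64 * C1 * (C1 + C2)) =
    n%:R * (2 * C1 * L * (2 * (C1 + C2) * L))); last by field.
  move=> h'; apply: (le_trans h').
  by rewrite le_eqVlt; apply/orP; left; apply/eqP; field.
- have : 2 * n%:R <= e ^+ 2 * L * n%:R by rewrite ler_wpM2r.
  by move=> h; apply: (le_trans h); rewrite le_eqVlt; apply/orP; left; apply/eqP; ring.
- by rewrite (mulrC n%:R) mulrA ler_wpM2r.
- apply: (@le_trans _ _ ((C4 * L) ^+ 2)); first by rewrite lerXn2r ?nnegrE ?addr_ge0 // mulr_ge0 // ltW.
  by rewrite exprMn [L ^+ 2]expr2 [leLHS]mulrA [leRHS]mulrA ler_wpM2r // ltW.
- exact: (le_trans C1L1 a1_ge).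
Qed.

(** * From every fixed accuracy to an error that tends to 0 *)

Lemma le_gnp_prob (R : realType) (n : nat) (p : R) (A B : pred {set {set 'I_n}}) :
  0 <= p -> p <= 1 -> (forall G, A G -> B G) -> gnp_prob p A <= gnp_prob p B.
Proof.
move=> p0 p1 AB; rewrite /gnp_prob !big_mkcondr; apply: ler_sum => G _.
have m0 : 0 <= gnp_mass p G by apply: submass_ge0.
by case: (boolP (A G)) => [/AB ->|_] //; case: ifP.
Qed.

(** At n use accuracy 1/(J + 1), where J is the largest j <= n for which accuracy 1/(j + 1) is
    already attained. Such j exist, as j = 0 only asks for a nonnegative probability, and J tends to
    infinity because each j is attained from some n on. *)
Lemma diagonal_rate (R : realType) (P : nat -> R -> R) :
  (forall n e, 0 <= P n e) ->
  (forall e, 0 < e -> exists N, forall n, (N <= n)%N -> 1 - e <= P n e) ->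
  exists2 eps : nat -> R, (eps n @[n --> \oo] --> (0 : R))%classic &
    forall n, 1 - eps n <= P n (eps n).
Proof.
move=> P0 PN.
pose Q j n := `[< 1 - j.+1%:R^-1 <= P n j.+1%:R^-1 >] : bool.
pose J n := \max_(j < n.+1 | Q j n) j.
exists (fun n => (J n).+1%:R^-1) => [|n]; last first.
  have Q0 : Q 0%N n by apply/asboolP; rewrite invr1 subrr.
  have [j Qj ->] : {j : 'I_n.+1 | Q j n & J n = j}.
    by apply: (@eq_bigmax_cond _ (fun j : 'I_n.+1 => Q j n)); apply/card_gt0P; exists ord0.
  exact/asboolP.
apply/cvgrPdist_le => /= e e0.
pose j := Num.truncn e^-1.
have je : j.+1%:R^-1 <= e.
  rewrite -[leRHS]invrK lef_pV2 ?posrE ?invr_gt0 //; apply/ltW/truncnS_gt.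
have [N NP] := PN j.+1%:R^-1 (ltac:(by rewrite invr_gt0)).
near=> n.
rewrite sub0r normrN ger0_norm ?invr_ge0 //; apply: le_trans je.
have jn : (j < n.+1)%N by rewrite ltnS; near: n; exact: nbhs_infty_ge.
rewrite lef_pV2 ?posrE // ler_nat ltnS.
apply: (@leq_bigmax_cond _ (fun i : 'I_n.+1 => Q i n) _ (Ordinal jn)).
by apply/asboolP/NP; near: n; exact: nbhs_infty_ge.
Unshelve. all: by end_near. Qed.

Local Open Scope classical_set_scope.

Theorem theorem2p8 (R : realType) (p : R) (s : nat)
    (p_gt0 : 0 < p) (p_lt1 : p < 1) (s_ge3 : (3 <= s)%N) :
  exists2 eps : nat -> R,
    eps n @[n --> \oo] --> (0 : R) &
    gnp_prob p (fun G : {set {set 'I_n}} =>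
        [exists H : {set {set 'I_n}},
           K_saturated s G H &&
           (`| #|H|%:R - n%:R * logb (1 / (1 - p)) n%:R |
              <= eps n * (n%:R * logb (1 / (1 - p)) n%:R))])
      @[n --> \oo] --> (1 : R).
Proof.
pose A n (e : R) (G : {set {set 'I_n}}) := [exists H : {set {set 'I_n}},
  K_saturated s G H && (`| #|H|%:R - n%:R * logb (1 / (1 - p)) n%:R |
              <= e * (n%:R * logb (1 / (1 - p)) n%:R))].
have p0 := ltW p_gt0; have p1 := ltW p_lt1.
have prob_ge0 n e : 0 <= gnp_prob p (@A n e).
  by apply: sumr_ge0 => G _; apply: submass_ge0.
have prob_le1 n e : gnp_prob p (@A n e) <= 1.
  by rewrite -(gnp_probT n p); apply: le_gnp_prob.
have [|eps eps0 epsP] := @diagonal_rate R (fun n e => gnp_prob p (@A n e)) prob_ge0.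
  (* Dividing by 9 brings both the edge error 9d and the failure probability 6d below e; the minimum
     ensures d <= 1. *)
  move=> e e0; pose d := Num.min e 1 / 9.
  have m0 : 0 < Num.min e 1 by rewrite lt_min e0 ltr01.
  have me : Num.min e 1 <= e by rewrite ge_min lexx.
  have m1 : Num.min e 1 <= 1 by rewrite ge_min lexx orbT.
  have k0 : (0 < s - 2)%N by rewrite subn_gt0.
  have [N NP] := @saturated_whp R p (s - 2) d p_gt0 p_lt1 k0
    (ltac:(by rewrite /d; lra)) (ltac:(by rewrite /d; lra)).
  (* The condition n >= 1 makes n log n nonnegative, so a larger relative error is a weaker
     demand. *)
  exists (maxn N 1) => n; rewrite geq_max => /andP[Nn n1].
  have nL : 0 <= n%:R * logb (1 / (1 - p)) n%:R.
    rewrite mulr_ge0 // divr_ge0 //; first by rewrite ln_ge0 // ler1n.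
    by rewrite ln_ge0 // div1r invf_ge1 ?subr_gt0 // gerBl.
  apply: (@le_trans _ _ (1 - 6 * d)); first by rewrite /d; lra.
  apply: (le_trans (NP n Nn)); apply: le_gnp_prob => // G.
  case/existsP => H /andP[Hs Hc]; apply/existsP; exists H; apply/andP; split.
    by move: Hs; rewrite -addn2 subnK // ltnW.
  by apply: (le_trans Hc); rewrite ler_wpM2r // /d; lra.
exists eps => //.
apply: (@squeeze_cvgr _ _ _ _ (fun n => 1 - eps n) (fun=> 1)).
- by apply: nearW => n; rewrite epsP prob_le1.
- by rewrite -[X in _ --> X]subr0; apply: cvgB => //; exact: cvg_cst.
- exact: cvg_cst.
Qed.
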